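(* Let $\psi:\mathbb{N}\to\mathbb{R}$ be any non-negative arithmetical function and let $c>0$. Define $f_c:[0,\infty)\to\mathbb{R}$ by \[ f_c(x) = \begin{cases} 0 & \text{if } x = 0,\\ x \exp\left(-c\, (\log (- \log x))(\log \log (-\log x)) \right) & \text{if } 0 < x < 1,\\ 1 & \text{if } x \ge 1. \end{cases} \] If \[ \sum_{n=1}^{\infty} f_c\!\left(\frac{\psi(n)}{n}\right) \varphi(n) = \infty, \] then $\lambda(W(\psi))=1$.
   Context: $\varphi$ denotes Euler's totient function and $\lambda$ denotes Lebesgue measure on $\mathbb{R}/\mathbb{Z}$. For each positive integer $n$, define $\mathcal{E}_n\subseteq\mathbb{R}/\mathbb{Z}$ by \[ \mathcal{E}_n := \bigcup_{\substack{a=1\\ \gcd(a,n)=1}}^{n}\left(\frac{a-\psi(n)}{n},\frac{a+\psi(n)}{n}\right), \] and let $W(\psi):=\limsup_{n\to\infty}\mathcal{E}_n=\bigcap_{m=1}^\infty\bigcup_{n\ge m}\mathcal{E}_n$, the set of points of $\mathbb{R}/\mathbb{Z}$ lying in infinitely many of the sets $\mathcal{E}_n$.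
   Formalization: For 1/e ≤ x < 1 the term log log(-log x) is the logarithm of a non-positive number, so f_c is undefined there as written; the formal statement takes f_c(x) = x on this range, which excludes no case whatever real values are assigned there. *)

(* Defs.v *)
From HB Require Import structures.
From mathcomp Require Import all_boot all_order all_algebra.
From mathcomp Require Import generic_quotient ring_quotient.
From mathcomp Require Import all_classical all_reals all_analysis.
Set Implicit Arguments.
Unset Strict Implicit.
Unset Printing Implicit Defensive.
Import Order.TTheory GRing.Theory Num.Theory.
Import numFieldNormedType.Exports.
Local Open Scope classical_set_scope.
Local Open Scope ring_scope.

Definition integers (R : realType) : zmodClosed R :=
  GRing.ZmodClosed.clone R (@Num.int_num_subdef R) _.

Definition circle (R : realType) : Type := Quotient.quot (integers R).
HB.instance Definition _ (R : realType) := GRing.Zmodule.on (circle R).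
HB.instance Definition _ (R : realType) := isPointed.Build (circle R) 0.

Definition circle_proj (R : realType) (x : R) : circle R :=
  (\pi_(Quotient.quot (integers R)) x)%qT.

Lemma circle_proj_eq (R : realType) (x y : R) :
  circle_proj x = circle_proj y <-> x - y \is a Num.int.
Proof.
have e : (x - y \is a Num.int) = (circle_proj x == circle_proj y).
  exact: (Quotient.idealrBE (integers R)).
by rewrite e; split => /eqP.
Qed.

Definition circle_display : measure_display. Proof. by []. Qed.

Section circle_measure.
Variable R : realType.

(* The quotient sigma-algebra of the Borel sets of R; it coincides with the
   Borel sets of R/Z. *)
Definition circle_measurable : set (set (circle R)) :=
  [set A | measurable (@circle_proj R @^-1` A)].

Let circle_measurable0 : circle_measurable set0.
Proof. by rewrite /circle_measurable /= preimage_set0. Qed.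

Let circle_measurableC A : circle_measurable A -> circle_measurable (~` A).
Proof.
by move=> mA; rewrite /circle_measurable /= preimage_setC; exact: measurableC.
Qed.

Let circle_measurable_bigcup (F : (set (circle R))^nat) :
  (forall i, circle_measurable (F i)) -> circle_measurable (\bigcup_i F i).
Proof.
move=> mF; rewrite /circle_measurable /= preimage_bigcup.
by apply: bigcup_measurable => i _; exact: mF.
Qed.

HB.instance Definition _ := @isMeasurable.Build circle_display (circle R)
  circle_measurable circle_measurable0 circle_measurableC
  circle_measurable_bigcup.

Lemma measurable_circle_proj :
  measurable_fun [set: measurableTypeR R] (@circle_proj R).
Proof. by move=> _ A mA; rewrite setTI. Qed.

(* Lebesgue (normalized Haar) measure on R/Z, via the fundamental domain
   [0, 1[. *)
Definition circle_lebesgue : set (circle R) -> \bar R :=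
  pushforward (mrestr (@lebesgue_measure R) (measurable_itv `[0, 1[))
    (@circle_proj R).

Let circle_lebesgue0 : circle_lebesgue set0 = 0%E.
Proof.
by rewrite /circle_lebesgue /pushforward /mrestr preimage_set0 set0I measure0.
Qed.

Let circle_lebesgue_ge0 A : (0 <= circle_lebesgue A)%E.
Proof.
by rewrite /circle_lebesgue /pushforward /mrestr; exact: outer_measure_ge0.
Qed.

Let circle_lebesgue_sigma_additive : semi_sigma_additive circle_lebesgue.
Proof.
move=> F mF tF mUF; rewrite /circle_lebesgue /pushforward preimage_bigcup.
apply: measure_semi_sigma_additive => //.
apply/trivIsetP => /= i j _ _ ij; rewrite -preimage_setI.
by move/trivIsetP : tF => /(_ _ _ _ _ ij) -> //; rewrite preimage_set0.
Qed.

HB.instance Definition _ := isMeasure.Build circle_display (circle R) R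
  circle_lebesgue circle_lebesgue0 circle_lebesgue_ge0
  circle_lebesgue_sigma_additive.

Let circle_lebesgue_setT : circle_lebesgue setT = 1%E.
Proof.
rewrite /circle_lebesgue /pushforward /mrestr preimage_setT setTI.
by rewrite lebesgue_measure_itv/= lte_fin ltr01 oppr0 adde0.
Qed.

HB.instance Definition _ := Measure_isProbability.Build circle_display
  (circle R) R circle_lebesgue circle_lebesgue_setT.

End circle_measure.

Section Duffin_Schaeffer.
Variables (R : realType) (psi : nat -> R).

Definition approx_set (n : nat) : set (circle R) :=
  \bigcup_(a in [set a : nat | (1 <= a <= n)%N /\ coprime a n])
    (@circle_proj R @`
       `](a%:R - psi n) / n%:R, (a%:R + psi n) / n%:R[).

Definition approx_limsup : set (circle R) := lim_sup_set approx_set.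

End Duffin_Schaeffer.

(* The function f_c.  The factor [ln (ln (- ln x))] has no meaning as a real
   number when [expR (-1) <= x < 1]; there it is 0, because [ln y = 0] for
   [y <= 0], so that f_c(x) = x.  Only small values of x matter: if
   psi(n)/n >= d > 0 for infinitely many n, then the corresponding
   [approx_set psi n] are eventually all of R/Z. *)
Definition extra_div_fun (R : realType) (c x : R) : R :=
  if x == 0 then 0
  else if x < 1 then x * expR (- c * ln (- ln x) * ln (ln (- ln x)))
  else 1.

(* Main.v *)
(* Put delta(n) = psi(n) / n.  On the block 2^(2^h) <= n < 2^(2^(h+1)) the weight in
   f_c is eventually smaller than 2^(-4h), so divergence gives infinitely many blocks
   with [\sum delta(n) phi(n) >= 2^(3h)].  In such a block one may shrink every
   delta(n) by a common factor 2^k, 0 <= k < h, and still have total length at least 1.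
   The overlap of the arcs with denominators m and n is governed by the number of
   pairs of reduced fractions at distance less than (delta(m) + delta(n)) / 2^k.
   Counting them by the numerator c of the difference, the excess over independence
   is a weighted sum over integers c coprime to m n / gcd(m, n)^2, cut off at a point
   proportional to 2^(-k).  This excess can be of order h for a given k, but it
   is bounded on average over the h scales.  So for some k the second moment is of
   the order of the square of the first, and the union of the arcs of the block has
   measure at least an absolute constant c0.

   The passage from c0 to 1 uses that c0 survives the replacement of psi by
   psi / 2^t and the restriction to any set of denominators with a divergent sum.
   Either the denominators n with 2-adic valuation exactly k diverge for some k, and
   the intersection over t of the resulting limsup sets is stable under the expanding
   map x -> 2 x + 2^(-k); or the multiples of 2^(k+1) diverge for every k, and their
   limsup sets are 2^(-k)-periodic.  In both cases Lebesgue's density theorem gives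
   full measure. *)
Require Import Defs.
From mathcomp Require Import all_boot all_order all_algebra.
From mathcomp Require Import all_classical all_reals all_analysis.
From mathcomp Require Import measurable_realfun.
From mathcomp Require Import ring lra zify.
Import Order.TTheory GRing.Theory Num.Theory.
Import numFieldNormedType.Exports.
Set Implicit Arguments.
Unset Strict Implicit.
Unset Printing Implicit Defensive.
Local Open Scope classical_set_scope.
Local Open Scope ring_scope.

(** * Chebyshev and Mertens bounds *)

Section Chebyshev.
Variable R : realType.

Definition mangoldt (k : nat) : R :=
  if (1 < k)%N && (k == pdiv k ^ logn (pdiv k) k)%N then ln (pdiv k)%:R else 0.

Lemma mangoldt_pfactor (p a : nat) : prime p -> (0 < a)%N ->
  mangoldt (p ^ a) = ln p%:R.
Proof.
move=> pp a0; rewrite /mangoldt; case: a a0 => // a _.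
by rewrite pdiv_pfactor// pfactorK// eqxx -(exp1n a.+1) ltn_exp2r// prime_gt1.
Qed.

Lemma mangoldt_neq0 (k : nat) : mangoldt k != 0 ->
  exists p a, [/\ prime p, (0 < a)%N & k = (p ^ a)%N].
Proof.
rewrite /mangoldt; case: ifPn => [/andP[k1 /eqP kE] _|]; last by rewrite eqxx.
exists (pdiv k), (logn (pdiv k) k); split => //; first exact: pdiv_prime.
by rewrite logn_gt0 mem_primes pdiv_prime//= pdiv_dvd ltnW.
Qed.

Lemma mangoldt_ge0 (k : nat) : 0 <= mangoldt k.
Proof.
rewrite /mangoldt; case: ifPn => // _; apply: ln_ge0.
by rewrite ler1n pdiv_gt0.
Qed.

(** Strong induction on [n = p * n'] with [p] the least prime divisor: among the divisors of [n]
    that do not divide [n'], only [p ^ v] is a prime power, and it contributes [ln p]. The cutoff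
    [N] is free so that sums over different [n] share one range and can be exchanged. *)
Lemma sum_mangoldt_dvd (n N : nat) : (0 < n)%N -> (n <= N)%N ->
  \sum_(1 <= k < N.+1 | (k %| n)%N) mangoldt k = ln n%:R.
Proof.
have [m] := ubnP n; elim: m n => // m IH n nm n0 nN.
have [n1|n1] := leqP n 1.
  have -> : n = 1%N by lia.
  rewrite ln1 big1 // => k /[!dvdn1]/eqP ->.
  by rewrite /mangoldt.
pose p := pdiv n; have pp : prime p by exact: pdiv_prime.
have p1 := prime_gt1 pp; have p0 := prime_gt0 pp.
have /dvdnP[n' nE] : (p %| n)%N by exact: pdiv_dvd.
have n'0 : (0 < n')%N by lia.
have n'n : (n' < n)%N by nia.
pose v := logn p n.
have vE : v = (logn p n').+1.
  by rewrite /v [in LHS]nE lognM// (logn_prime _ pp) eqxx addn1.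
rewrite (bigID (fun k => k %| n')%N) /=.
rewrite (eq_bigl (fun k => k %| n')%N); last first.
  move=> k; rewrite andb_idl// => kn'; by rewrite nE dvdn_mulr.
rewrite IH//; [|lia|lia].
have pvN : (p ^ v < N.+1)%N.
  by rewrite ltnS (leq_trans _ nN)// dvdn_leq// pfactor_dvdnn.
rewrite big_mkcond/= (bigD1_seq (p ^ v)%N) /=; last 2 first.
  - by rewrite mem_index_iota pvN expn_gt0 p0.
  - exact: iota_uniq.
rewrite pfactor_dvdnn/= pfactor_dvdn// vE ltnn/= mangoldt_pfactor//.
rewrite big1_seq ?addr0 => [|k /andP[kpv _]].
  by rewrite [in RHS]nE natrM lnM ?posrE ?ltr0n.
case: ifPn => // /andP[kn kn'].
apply/eqP/contraT => /mangoldt_neq0[q [a [pq a0 kE]]]; exfalso.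
move: kn kn' kpv; rewrite kE !pfactor_dvdn// nE lognM// (logn_prime _ pp).
case: eqVneq => [->|qp]; last by rewrite addn0 => ->.
rewrite addn1 -ltnNge => h1 h2; have -> : a = (logn p n').+1 by lia.
by rewrite eqxx.
Qed.

Lemma sum_ln (N : nat) :
  \sum_(1 <= n < N.+1) ln (n%:R : R) =
  \sum_(1 <= k < N.+1) mangoldt k * (N %/ k)%:R.
Proof.
transitivity (\sum_(1 <= n < N.+1) \sum_(1 <= k < N.+1) mangoldt k * (k %| n)%:R).
  apply: eq_big_nat => n /andP[n0 nN]; rewrite -(@sum_mangoldt_dvd n N)//.
  rewrite big_mkcond/=; apply: eq_bigr => k _.
  by case: ifP; rewrite ?mulr1 ?mulr0.
rewrite exchange_big/=; apply: eq_bigr => k _.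
by rewrite -mulr_sumr divn_count_dvd natr_sum.
Qed.

Lemma sum_ln_fact (N : nat) : \sum_(1 <= n < N.+1) ln (n%:R : R) = ln (N`!)%:R.
Proof.
elim: N => [|N IH]; first by rewrite big_geq// fact0 ln1.
rewrite big_nat_recr//= IH factS natrM lnM ?posrE ?ltr0n ?fact_gt0//.
by rewrite addrC.
Qed.

Definition chebyshev (N : nat) : R := \sum_(1 <= k < N.+1) mangoldt k.

Lemma bin2n_le (N : nat) : ('C(N.*2, N) <= 2 ^ N.*2)%N.
Proof.
rewrite -[X in (_ <= X ^ _)%N](addn1 1) expnDn.
rewrite (bigD1 (inord N : 'I_(N.*2).+1))//= inordK; last by lia.
by rewrite !exp1n !muln1 leq_addr.
Qed.

(* In [ln 'C(2N, N) = \sum_k mangoldt k * (2N %/ k - 2 (N %/ k))] the coefficients are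
   nonnegative, and equal to 1 for [N < k <= 2N]. *)
Lemma chebyshev_double (N : nat) :
  chebyshev N.*2 <= chebyshev N + N.*2%:R * ln 2.
Proof.
suff : chebyshev N.*2 - chebyshev N <= ln 'C(N.*2, N)%:R :> R.
  have : ln 'C(N.*2, N)%:R <= N.*2%:R * ln 2 :> R.
    rewrite mulr_natl -lnXn// ler_ln ?posrE ?exprn_gt0//; last first.
      by rewrite ltr0n bin_gt0; lia.
    by rewrite -natrX ler_nat bin2n_le.
  lra.
have -> : ln 'C(N.*2, N)%:R = ln (N.*2)`!%:R - ln N`!%:R *+ 2 :> R.
  have <- := @bin_fact N.*2 N; last by lia.
  rewrite (_ : N.*2 - N = N)%N; last by lia.
  rewrite !natrM !lnM ?posrE ?mulr_gt0 ?ltr0n ?fact_gt0 ?bin_gt0; try lia.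
  lra.
rewrite -!sum_ln_fact !sum_ln /chebyshev.
rewrite (@big_cat_nat _ _ _ N.+1 1 N.*2.+1)//=; last by lia.
rewrite [X in _ <= X - _](@big_cat_nat _ _ _ N.+1 1 N.*2.+1)//=; last by lia.
rewrite -sumrMnl [X in X <= _]addrC addKr [X in _ <= X]addrAC -sumrB -[leLHS]add0r.
apply: lerD.
  apply: sumr_ge0 => k _; rewrite -mulrnAr -mulrBr mulr_ge0 ?mangoldt_ge0//.
  rewrite subr_ge0 -mulrnA ler_nat.
  case: k => // k; rewrite leq_divRL//.
  by have := leq_trunc_div N k.+1; lia.
apply: ler_sum_nat => k /andP[Nk kN]; rewrite ler_peMr ?mangoldt_ge0//.
by rewrite ler1n divn_gt0; lia.
Qed.

Lemma chebyshevS (N : nat) : chebyshev N.+1 = chebyshev N + mangoldt N.+1.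
Proof. by rewrite /chebyshev big_nat_recr. Qed.

Lemma mangoldt_le (n : nat) : (0 < n)%N -> mangoldt n <= ln n%:R.
Proof.
move=> n0; rewrite /mangoldt; case: ifPn => _.
  by rewrite ler_ln ?posrE ?ltr0n ?pdiv_gt0// ler_nat pdiv_leq.
by rewrite ln_ge0// ler1n.
Qed.

Lemma ln2_le1 : ln 2 <= 1 :> R.
Proof. have : ln (1 + 1) <= 1 :> R by apply: le_ln1Dx; lra. by []. Qed.

(** Strong induction by halving: [chebyshev_double] and [ln 2 <= 1] give [6 * M] at [2 * M], and the
    slack up to [8 * M] absorbs the extra term [mangoldt (2 * M + 1)] when [N] is odd. *)
Lemma chebyshev_le (N : nat) : chebyshev N <= 4 * N%:R.
Proof.
have [m] := ubnP N; elim: m N => // m IH N Nm.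
have [->|N0] := posnP N; first by rewrite /chebyshev big_geq// mulr0.
have dbl (M : nat) : (M < N)%N -> chebyshev M.*2 <= 6 * M%:R.
  move=> MN; rewrite (le_trans (chebyshev_double M))//.
  have := IH M; rewrite (leq_trans MN)// => /(_ isT) h.
  have : M.*2%:R * ln 2 <= 2 * M%:R * 1 :> R.
    by rewrite -mul2n natrM ler_wpM2l// ln2_le1.
  lra.
rewrite -(odd_double_half N); set M := N./2.
have NE := odd_double_half N; rewrite -/M in NE.
case: (odd N) NE => /= NE.
  have hM : (M < N)%N by lia.
  rewrite add1n chebyshevS (le_trans (lerD (dbl M hM) (mangoldt_le _)))//.
  have : ln (M.*2.+1)%:R <= M.*2%:R :> R.
    by rewrite -natr1 addrC le_ln1Dx// (lt_le_trans (y := 0))// ltrN10.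
  rewrite -[in X in _ -> _ <= X]natr1 -mul2n natrM => h.
  have : 0 <= M%:R :> R by []. lra.
rewrite add0n (le_trans (dbl M _))//; first by lia.
rewrite -mul2n natrM; have : 0 <= M%:R :> R by []. lra.
Qed.

(* Compare [\sum_(k <= N) mangoldt k * (N / k)] with [ln N! = \sum_k mangoldt k * (N %/ k)]. *)
Lemma mertens_first (N : nat) : (0 < N)%N ->
  \sum_(1 <= k < N.+1) mangoldt k / k%:R <= ln N%:R + 4.
Proof.
move=> N0; have N0R : (0 : R) < N%:R by rewrite ltr0n.
rewrite -(ler_pM2l N0R) mulr_sumr.
apply: (@le_trans _ _ (\sum_(1 <= k < N.+1) mangoldt k * (N %/ k)%:R + chebyshev N)).
  rewrite /chebyshev -big_split/=; apply: ler_sum_nat => k /andP[k0 _].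
  rewrite -[X in _ <= _ + X]mulr1 -mulrDr mulrCA ler_wpM2l ?mangoldt_ge0//.
  rewrite ler_pdivrMr ?ltr0n// natr1 -natrM ler_nat ltnW//.
  exact: ltn_ceil.
rewrite mulrDr -sum_ln lerD//; last by rewrite mulrC chebyshev_le.
apply: (@le_trans _ _ (\sum_(1 <= k < N.+1) ln N%:R)).
  apply: ler_sum_nat => k /andP[k0 kN]; rewrite ler_ln ?posrE ?ltr0n//.
  by rewrite ler_nat.
by rewrite sumr_const_nat subSS subn0 mulr_natl.
Qed.

End Chebyshev.

Section PrimeSums.
Variable R : realType.

Lemma sum_ln_prime (N : nat) : (0 < N)%N ->
  \sum_(1 <= p < N.+1 | prime p) ln p%:R / p%:R <= ln N%:R + 4 :> R.
Proof.
move=> /(mertens_first R); apply: le_trans; rewrite big_mkcond/=.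
apply: ler_sum_nat => p _; case: ifPn => pp.
  by rewrite -{3}(expn1 p) mangoldt_pfactor.
by rewrite divr_ge0 ?mangoldt_ge0.
Qed.

(* By Abel summation, written as the monotonicity in [N] of
   [P N - A N / ln N - ln (ln N) + 4 / ln N]. *)
Lemma mertens_second : exists C : R, forall N : nat, (2 <= N)%N ->
  \sum_(1 <= p < N.+1 | prime p) p%:R^-1 <= ln (ln N%:R) + C.
Proof.
pose A (N : nat) : R := \sum_(1 <= p < N.+1 | prime p) ln p%:R / p%:R.
pose P (N : nat) : R := \sum_(1 <= p < N.+1 | prime p) p%:R^-1.
pose l (N : nat) : R := ln N%:R.
have l_gt0 N : (2 <= N)%N -> 0 < l N by move=> N2; rewrite ln_gt0// ltr1n.
have PS N : P N.+1 = P N + (if prime N.+1 then N.+1%:R^-1 else 0).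
  by rewrite /P big_mkcond big_nat_recr//= -big_mkcond.
have AS N : A N.+1 = A N + (if prime N.+1 then l N.+1 / N.+1%:R else 0).
  by rewrite /A big_mkcond big_nat_recr//= -big_mkcond.
exists (1 - ln (ln 2) + 4 / ln 2) => N N2.
have main : P N - A N / l N <= ln (l N) - 4 / l N - ln (l 2%N) + 4 / l 2%N.
  elim: N N2 => // N IH; rewrite leq_eqVlt => /predU1P[<-|].
    have -> : P 2%N = 2^-1 by rewrite /P big_ltn_cond//= big_ltn_cond//= big_geq// addr0.
    have -> : A 2%N = l 2%N / 2 by rewrite /A big_ltn_cond//= big_ltn_cond//= big_geq// addr0.
    rewrite mulrAC divff ?gt_eqF ?l_gt0//; lra.
  rewrite ltnS => N2; have {IH} := IH N2.
  have lN := l_gt0 _ N2; have lN1 : 0 < l N.+1 by apply: l_gt0; lia.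
  have AN : A N <= l N + 4 by apply: sum_ln_prime; lia.
  have -> : P N.+1 - A N.+1 / l N.+1 = P N - A N / l N.+1.
    rewrite PS AS; case: ifPn => _; last by rewrite !addr0.
    by field; rewrite gt_eqF//= -natr1 pnatr_eq0.
  have inv_le : (l N.+1)^-1 <= (l N)^-1.
    by rewrite lef_pV2 ?posrE// ler_ln ?posrE ?ltr0n ?ler_nat//; lia.
  (* [A N] is multiplied by a nonnegative difference of reciprocals, so the upper bound of the first
     Mertens estimate suffices. *)
  have step : A N * ((l N)^-1 - (l N.+1)^-1) <= (l N + 4) * ((l N)^-1 - (l N.+1)^-1).
    by rewrite ler_wpM2r// subr_ge0.
  have lnln : 1 - l N / l N.+1 <= ln (l N.+1) - ln (l N).
    have : ln (1 + (l N / l N.+1 - 1)) <= l N / l N.+1 - 1.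
      by apply: le_ln1Dx; rewrite ltrBrDr addNr divr_gt0.
    rewrite addrC subrK ln_div ?posrE//; lra.
  have e : (l N + 4) * ((l N)^-1 - (l N.+1)^-1) =
           1 - l N / l N.+1 + 4 / l N - 4 / l N.+1.
    by field; rewrite !gt_eqF.
  rewrite e in step; lra.
have AN : A N / l N <= 1 + 4 / l N.
  rewrite ler_pdivrMr ?l_gt0// mulrDl mul1r divfK ?gt_eqF ?l_gt0//.
  by apply: sum_ln_prime; lia.
rewrite -/(P N) -/(l N).
have : 4 / l N <= 4 / l 2%N.
  by rewrite ler_pM2l// lef_pV2 ?posrE ?l_gt0// ler_ln ?posrE ?ltr0n ?ler_nat//; lia.
rewrite -[ln 2]/(l 2%N). lra.
Qed.

End PrimeSums.

(** * The ratio [totient n / n] as a product over primes *)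

Section Rho.
Variable R : realType.

(** For [n > 0] this is [totient n / n]. The product form allows comparison prime by prime between
    different moduli. *)
Definition rho (n : nat) : R := \prod_(p <- primes n) (1 - p%:R^-1).

Lemma big_primes (T : Type) (idx : T) (op : Monoid.law idx) (n m : nat) (F : nat -> T) :
  (n < m)%N -> \big[op/idx]_(p <- primes n) F p =
  \big[op/idx]_(0 <= p < m | p \in primes n) F p.
Proof. by move=> nm; rewrite -[in LHS](filter_pi_of nm) big_filter. Qed.

Lemma prime_inv (p : nat) : prime p -> (0 < p%:R^-1 :> R) /\ (p%:R^-1 <= 2^-1 :> R).
Proof.
move=> pp; rewrite invr_gt0 ltr0n prime_gt0//; split => //.
by rewrite lef_pV2 ?posrE ?ltr0n ?ler_nat ?prime_gt0 ?prime_gt1.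
Qed.

Lemma rho_gt0 (n : nat) : 0 < rho n.
Proof.
rewrite /rho big_seq; apply: prodr_gt0 => p; rewrite mem_primes => /andP[pp _].
have [] := prime_inv pp; lra.
Qed.

Lemma totient_rho (n : nat) : (0 < n)%N -> (totient n)%:R = n%:R * rho n.
Proof.
move=> n0; rewrite totientE// natr_prod.
have -> : n%:R = \prod_(p <- primes n) (p ^ logn p n)%:R :> R.
  by rewrite [in LHS](prod_prime_decomp n0) prime_decompE big_map/= natr_prod.
rewrite /rho -big_split/=.
rewrite big_seq [RHS]big_seq; apply: eq_bigr => p pn.
have : (0 < logn p n)%N by rewrite logn_gt0.
move: pn; rewrite mem_primes => /andP[pp _]; case: (logn p n) => // a _ /=.
have p0 := prime_gt0 pp; rewrite natrM expnSr natrM -mulrA mulrC; congr *%R.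
rewrite mulrBr mulr1 divff ?pnatr_eq0; last by lia.
by rewrite -subn1 natrB.
Qed.

Lemma sum_inv_pred_prod (N : nat) : (0 < N)%N ->
  \sum_(2 <= k < N.+1) (k%:R * (k%:R - 1))^-1 = 1 - N%:R^-1 :> R.
Proof.
elim: N => // -[|N] IH _; first by rewrite big_geq// invr1 subrr.
rewrite big_nat_recr//= IH// -[N.+2%:R]natr1 -[N.+1%:R]natr1.
have N_ge0 := ler0n R N.
by field; apply/andP; split; rewrite gt_eqF//; lra.
Qed.

Lemma sum_primes_inv2_le (s : seq nat) : uniq s -> all prime s ->
  \sum_(p <- s) (p%:R * (p%:R - 1))^-1 <= 1 :> R.
Proof.
move=> us /allP sp.
pose N := (\max_(p <- s) p).+1.
rewrite (@le_trans _ _ (\sum_(2 <= k < N.+1) (k%:R * (k%:R - 1))^-1))//; last first.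
  by rewrite sum_inv_pred_prod// gerBl invr_ge0.
rewrite [leRHS](bigID (fun k => k \in s))/= -[leLHS]addr0 lerD//; last first.
  rewrite big_seq_cond; apply: sumr_ge0 => k /andP[].
  rewrite mem_index_iota => /andP[k2 _] _.
  by rewrite invr_ge0 mulr_ge0// subr_ge0 ler1n ltnW.
rewrite -[leRHS]big_filter le_eqVlt; apply/orP; left; apply/eqP/perm_big.
apply: uniq_perm => //; first by rewrite filter_uniq// iota_uniq.
move=> k; rewrite mem_filter andb_idr// => ks; rewrite mem_index_iota.
rewrite prime_gt1 ?sp//= /N ltnS ltnW// ltnS.
by rewrite (big_rem k)//= leq_maxl.
Qed.

(** Each factor satisfies [1 / (1 - 1 / p) = 1 + 1 / (p - 1) <= exp (1 / (p - 1))], and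
    [1 / (p - 1)] exceeds [1 / p] by [1 / (p (p - 1))]. These excesses sum to at most 1, whence the
    factor [expR 1]. *)
Lemma expR_inv_primes_le (n : nat) :
  expR (- \sum_(p <- primes n) p%:R^-1) <= expR 1 * rho n.
Proof.
rewrite -ler_pdivrMl ?expR_gt0// -expRN -expRD.
apply: (@le_trans _ _ (expR (\sum_(p <- primes n) (- (p%:R - 1)^-1)))).
  rewrite ler_expR.
  have := @sum_primes_inv2_le (primes n) (primes_uniq n) (all_prime_primes n).
  suff -> : \sum_(p <- primes n) (- (p%:R - 1)^-1) = - \sum_(p <- primes n) p%:R^-1
     - \sum_(p <- primes n) (p%:R * (p%:R - 1))^-1 :> R by lra.
  rewrite -!sumrN -big_split/=.
  rewrite big_seq [RHS]big_seq; apply: eq_bigr => p.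
  rewrite mem_primes => /andP[pp _]; have := prime_gt1 pp.
  rewrite -(ltr1n R) => p1; field; rewrite !gt_eqF// ?subr_gt0//; lra.
rewrite expR_sum /rho big_seq [leRHS]big_seq; apply: ler_prod => p.
rewrite mem_primes => /andP[pp _]; have := prime_gt1 pp.
rewrite -(ltr1n R) => p1; rewrite expR_ge0/= expRN.
rewrite -[leRHS]invrK lef_pV2 ?posrE ?expR_gt0//; last first.
  by rewrite invr_gt0 subr_gt0 invf_lt1//; lra.
have -> : (1 - p%:R^-1 : R)^-1 = 1 + (p%:R - 1)^-1.
  by field; rewrite !gt_eqF//; lra.
exact: expR_ge1Dx.
Qed.

End Rho.

(** * Sums over integers coprime to a modulus *)

Section CoprimeSums.
Variable R : realType.

Lemma sum_geometric_le (x : R) (n : nat) : 0 <= x < 1 ->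
  \sum_(0 <= i < n) x ^+ i <= (1 - x)^-1.
Proof.
move=> /andP[x0 x1]; rewrite -[leRHS]div1r ler_pdivlMr ?subr_gt0//.
rewrite big_mkord mulrC -opprB mulNr -subrX1 opprB gerBl; exact: exprn_ge0.
Qed.

Lemma sum_totient_pfactor_le (p N : nat) : prime p ->
  \sum_(0 <= a < N) (totient (p ^ a))%:R^-1 <= 1 + p%:R / (p%:R - 1) ^+ 2 :> R.
Proof.
move=> pp; have := prime_gt1 pp; rewrite -(ltr1n R) => p1.
case: N => [|N].
  rewrite big_geq// addr_ge0// divr_ge0// exprn_ge0//; lra.
rewrite big_nat_recl//= expn0 -[totient 1]/1%N invr1 lerD2l.
rewrite (eq_bigr (fun a : nat => (p%:R - 1)^-1 * (p%:R^-1) ^+ a)); last first.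
  move=> a _; rewrite totient_pfactor// natrM -subn1 natrB ?prime_gt0//=.
  by rewrite natrX invfM exprVn.
rewrite -mulr_sumr.
have -> : p%:R / (p%:R - 1) ^+ 2 = (p%:R - 1)^-1 * (1 - p%:R^-1)^-1 :> R.
  by field; apply/andP; split; rewrite gt_eqF//; lra.
rewrite ler_wpM2l// ?invr_ge0; first by lra.
by apply: sum_geometric_le; rewrite invr_ge0 ler0n/= invf_lt1//; lra.
Qed.

(** Truncated Euler product of the multiplicative function [1 / totient]. By induction on [s]: every
    admissible [c] is [p ^ a * b] with [b] supported on the remaining primes, and the powers of [p]
    form a geometric series. *)
Lemma euler_product_le (s : seq nat) (N : nat) : uniq s -> all prime s ->
  \sum_(1 <= c < N.+1 | all (mem s) (primes c)) (totient c)%:R^-1 <=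
  \prod_(p <- s) (1 + p%:R / (p%:R - 1) ^+ 2) :> R.
Proof.
pose F c : R := (totient c)%:R^-1.
have F0 c : 0 <= F c by rewrite invr_ge0.
elim: s => [_ _|p s IH /= /andP[ps us] /andP[pp sp]].
  rewrite big_nil big_mkcond/=.
  case: N => [|N]; first by rewrite big_geq.
  rewrite big_ltn// -[totient 1]/1%N invr1/= gerDl big_nat big1// => c /andP[c1 _].
  case: ifPn => //; case: (primes c) (primes_eq0 c) => //=.
  by rewrite eqxx ltnNge c1.
rewrite big_cons.
(* The indicator of [c = p ^ a * b] allows the sum over [c] to be done first; at most one [c] then
   survives for each pair [(a, b)]. *)
apply: (@le_trans _ _ (\sum_(1 <= c < N.+1) \sum_(0 <= a < N.+1)
   \sum_(1 <= b < N.+1 | all (mem s) (primes b)) (c == p ^ a * b)%N%:R * F c)).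
  rewrite big_mkcond/=; apply: ler_sum_nat => c /andP[c0 cN].
  have rhs0 a : 0 <= \sum_(1 <= b < N.+1 | all (mem s) (primes b))
      (c == p ^ a * b)%N%:R * F c by apply: sumr_ge0 => b _; rewrite mulr_ge0.
  case: ifPn => cs; last exact: sumr_ge0.
  pose a := logn p c; pose b := (c`_p^')%N.
  have cE : c = (p ^ a * b)%N by rewrite /a /b -p_part partnC.
  have b0 : (0 < b)%N by rewrite part_gt0.
  have aN : a \in index_iota 0 N.+1.
    by rewrite mem_index_iota/= (leq_trans (ltn_logl _ _))// ltnW.
  rewrite (bigD1_seq a aN (iota_uniq _ _))/=.
  rewrite -[leLHS]addr0 lerD//; last exact: sumr_ge0.
  rewrite big_mkcond (bigD1_seq b)/= ?iota_uniq//; last first.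
    by rewrite mem_index_iota b0 (leq_ltn_trans _ cN)// dvdn_leq// /b dvdn_part.
  have -> : all (mem s) (primes b).
    rewrite /b primes_part; apply/allP => q; rewrite mem_filter => /andP[qp qc].
    move/allP : cs => /(_ _ qc); rewrite !inE => /predU1P[qE|//].
    by move: qp; rewrite qE !inE eqxx.
  rewrite -cE eqxx mul1r lerDl; apply: sumr_ge0 => b' _.
  by case: ifP => // _; rewrite mulr_ge0.
rewrite exchange_big/=.
apply: (@le_trans _ _ (\sum_(0 <= a < N.+1) F (p ^ a)%N *
   \sum_(1 <= b < N.+1 | all (mem s) (primes b)) F b)); last first.
  rewrite -mulr_suml ler_pM//; [exact: sumr_ge0|exact: sumr_ge0| |exact: IH].
  exact: sum_totient_pfactor_le.
apply: ler_sum_nat => a _; rewrite mulr_sumr exchange_big_idem/= ?addr0//.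
rewrite big_mkcond [leRHS]big_mkcond/=; apply: ler_sum_nat => b /andP[b0 _].
case: ifPn => // bs.
have -> : F (p ^ a)%N * F b = F (p ^ a * b)%N.
  rewrite /F totient_coprime ?natrM ?invfM//.
  case: a => [|a]; first by rewrite coprime1n.
  rewrite coprime_pexpl// prime_coprime//; apply/negP => pb.
  move/allP : bs => /(_ p); rewrite mem_primes pp b0 pb => /(_ isT).
  by move=> /= ps'; rewrite ps' in ps.
have [kN|kN] := boolP (p ^ a * b \in index_iota 1 N.+1)%N.
  rewrite (bigD1_seq (p ^ a * b)%N)/= ?iota_uniq// eqxx mul1r gerDl.
  by rewrite big1// => c /negbTE ->; rewrite mul0r.
rewrite big_seq big1// => c cN; case: eqVneq => [cE|_]; last by rewrite mul0r.
by rewrite -cE cN in kN.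
Qed.

(** Separates the divergent part [1 / p] from a summable remainder. After clearing denominators the
    inequality is [p ^ 2 <= p ^ 2 + p - 2]. *)
Lemma euler_factor_le (p : nat) : prime p ->
  1 + p%:R / (p%:R - 1) ^+ 2 <= expR (p%:R^-1 + 3 * (p%:R * (p%:R - 1))^-1) :> R.
Proof.
move=> pp; have := prime_gt1 pp; rewrite -(ler_nat R) => p2.
apply: le_trans (expR_ge1Dx _); rewrite lerD2l.
have e1 : p%:R * (p%:R - 1) ^+ 2 > 0 :> R by rewrite mulr_gt0 ?exprn_gt0//; lra.
rewrite -(ler_pM2r e1).
have -> : p%:R / (p%:R - 1) ^+ 2 * (p%:R * (p%:R - 1) ^+ 2) = p%:R ^+ 2 :> R.
  by field; rewrite gt_eqF//; lra.
have -> : (p%:R^-1 + 3 * (p%:R * (p%:R - 1))^-1) * (p%:R * (p%:R - 1) ^+ 2) =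
   (p%:R - 1) ^+ 2 + 3 * (p%:R - 1) :> R.
  by field; rewrite !gt_eqF//; lra.
nra.
Qed.

Lemma size_primes (n : nat) : (0 < n)%N -> (2 ^ size (primes n) <= n)%N.
Proof.
move=> n0; rewrite [leqRHS](prod_prime_decomp n0) prime_decompE big_map/=.
have -> : forall s : seq nat, (2 ^ size s = \prod_(p <- s) 2)%N.
  by elim=> [|x s IH]; rewrite ?big_nil// big_cons -IH -expnS.
rewrite big_seq [leqRHS]big_seq; apply: leq_prod => p pn.
have pp : prime p by move: pn; rewrite mem_primes => /andP[].
rewrite -logn_gt0 in pn; rewrite (leq_trans (prime_gt1 pp))//.
by rewrite -[leqLHS]expn1 leq_pexp2l// prime_gt0.
Qed.

(** Only primes [p <= z] not dividing [q] occur in [c]. Mertens' bound over all [p <= z] gives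
    [ln z], and removing the primes of [q] gives [rho q]. The primes of [q] above [z] cannot be
    removed, but there are at most [2 * z] of them, each with reciprocal at most [1 / z]. The
    constant 6 is 2 for these primes, 3 for the remainder in [euler_factor_le] and 1 from
    [expR_inv_primes_le]. *)
Lemma sum_inv_totient_coprime : exists2 C : R, 0 < C & forall z q : nat,
  (2 <= z)%N -> (0 < q)%N -> (size (primes q) <= 2 * z)%N ->
  \sum_(1 <= c < z.+1 | coprime c q) (totient c)%:R^-1 <= C * ln z%:R * rho R q.
Proof.
have [C0 hC0] := mertens_second R.
exists (expR (C0 + 6)); first exact: expR_gt0.
move=> z q z2 q0 qz.
pose s := [seq p <- index_iota 1 z.+1 | prime p && ~~ (p %| q)%N].
have us : uniq s by rewrite filter_uniq// iota_uniq.
have sp : all prime s by apply/allP => p; rewrite mem_filter => /andP[/andP[]].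
apply: (@le_trans _ _ (\sum_(1 <= c < z.+1 | all (mem s) (primes c))
    (totient c)%:R^-1)).
  rewrite big_mkcond [leRHS]big_mkcond/=; apply: ler_sum_nat => c /andP[c0 cz].
  case: ifPn => cq; last by case: ifPn => _; rewrite ?invr_ge0.
  rewrite ifT//; apply/allP => p; rewrite mem_primes => /and3P[pp _ pc] /=.
  rewrite mem_filter pp mem_index_iota prime_gt0//=.
  rewrite (leq_ltn_trans (dvdn_leq _ pc))// andbT; apply/negP => pq.
  have : (p %| gcdn c q)%N by rewrite dvdn_gcd pc.
  rewrite (eqP cq) dvdn1 => /eqP p1; by rewrite p1 in pp.
apply: (le_trans (euler_product_le _ us sp)).
apply: (@le_trans _ _ (expR (\sum_(p <- s) p%:R^-1 + 3))).
  apply: (@le_trans _ _ (expR (\sum_(p <- s) p%:R^-1 +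
      3 * \sum_(p <- s) (p%:R * (p%:R - 1))^-1))).
    rewrite mulr_sumr -big_split/= expR_sum big_seq [leRHS]big_seq.
    apply: ler_prod => p ps; rewrite euler_factor_le ?(allP sp)// andbT.
    by rewrite addr_ge0// divr_ge0// exprn_ge0// subr_ge0 ler1n prime_gt0// (allP sp).
  rewrite ler_expR lerD2l.
  have := sum_primes_inv2_le R us sp; lra.
have split_sum : \sum_(p <- s) p%:R^-1 <=
    ln (ln z%:R) + C0 + 2 - \sum_(p <- primes q) p%:R^-1 :> R.
  have : \sum_(p <- primes q | (p <= z)%N) p%:R^-1 + \sum_(p <- s) p%:R^-1
      <= ln (ln z%:R) + C0.
    apply: le_trans (hC0 z z2); rewrite [leRHS](bigID (fun p => p %| q)%N)/=.
    rewrite lerD//; last by rewrite /s big_filter.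
    rewrite -big_filter -[leRHS]big_filter le_eqVlt; apply/orP; left; apply/eqP.
    apply: perm_big; apply: uniq_perm; rewrite ?filter_uniq ?primes_uniq ?iota_uniq//.
    move=> p; rewrite !mem_filter mem_primes mem_index_iota q0 ltnS.
    by case: (boolP (prime p)) => [pp|]; rewrite ?andbF//= prime_gt0//= andbC.
  have : \sum_(p <- primes q | ~~ (p <= z)%N) p%:R^-1 <= 2 :> R.
    apply: (@le_trans _ _ (\sum_(p <- primes q) z%:R^-1)).
      rewrite big_mkcond/=; apply: ler_sum => p _; case: ifPn => // zp.
      rewrite -ltnNge in zp; rewrite lef_pV2 ?posrE ?ltr0n ?ler_nat; lia.
    rewrite big_const_seq count_predT iter_addr_0 -[leLHS]mulr_natl ler_pdivrMr ?ltr0n; last by lia.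
    by rewrite -natrM ler_nat.
  rewrite [X in _ - X](bigID (fun p => p <= z)%N)/=; lra.
apply: (@le_trans _ _ (expR (ln (ln z%:R) + (C0 + 5) - \sum_(p <- primes q) p%:R^-1))).
  by rewrite ler_expR; lra.
have lz : 0 < ln z%:R :> R by rewrite ln_gt0// ltr1n.
have -> : expR (C0 + 6) = expR (C0 + 5) * expR 1 by rewrite -expRD; congr expR; lra.
rewrite expRD [expR (_ + (C0 + 5))]expRD lnK ?posrE//.
rewrite [leRHS](_ : _ = ln z%:R * expR (C0 + 5) * (expR 1 * rho R q)); last by ring.
by rewrite ler_wpM2l ?expR_inv_primes_le// mulr_ge0 ?expR_ge0// ltW.
Qed.

(** Multiplying [b] by a power of [p] leaves [rho] unchanged if [p] divides [b], and otherwise costs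
    the factor [1 - 1 / p >= 1 / 2]. *)
Lemma totient_pfactorM_ge (p a b : nat) : prime p -> (0 < a)%N ->
  (p ^ a * totient b <= 2 * totient (p ^ a * b))%N.
Proof.
move=> pp a0; have [->|b0] := posnP b; first by rewrite !muln0.
have p0 := prime_gt0 pp.
rewrite -(ler_nat R) !natrM !totient_rho ?muln_gt0 ?expn_gt0 ?p0// natrM.
have : rho R b <= 2 * rho R (p ^ a * b).
  have pab : primes (p ^ a * b) =i p :: primes b.
    by move=> q; rewrite primesM ?expn_gt0 ?p0// primesX// primes_prime// !inE.
  have [pb|pb] := boolP (p \in primes b).
    have -> : rho R (p ^ a * b) = rho R b.
      rewrite /rho; congr (\prod_(_ <- _) _); apply/eq_primes => q.
      by rewrite pab inE orb_idl// => /eqP ->.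
    have := rho_gt0 R b; lra.
  have -> : rho R (p ^ a * b) = (1 - p%:R^-1) * rho R b.
    rewrite /rho -(big_cons _ _ p (primes b) xpredT); apply: perm_big.
    by apply: uniq_perm => //; rewrite ?primes_uniq// cons_uniq pb primes_uniq.
  have [_ p2] := prime_inv R pp; have rb := rho_gt0 R b.
  rewrite mulrA -[leLHS]mul1r; apply: ler_wpM2r; [exact: ltW|lra].
move=> h; rewrite (_ : _ * (_ * _) = (p ^ a)%:R * b%:R * rho R b); last by ring.
rewrite [leRHS](_ : _ = (p ^ a)%:R * b%:R * (2 * rho R (p ^ a * b))); last by ring.
by rewrite ler_wpM2l// mulr_ge0.
Qed.

(* Comparing [\sum f(c) ln c = \sum_k mangoldt k \sum_b f(k b)] with
   [\sum f(c) / c] turns the logarithmic sum of [f] into a sieve bound for the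
   plain sum, without any sieve. *)
Lemma sum_coprime_div_totient : exists2 C : R, 0 < C & forall z q : nat,
  (2 <= z)%N -> (0 < q)%N -> (size (primes q) <= 2 * z)%N ->
  \sum_(1 <= c < z.+1 | coprime c q) c%:R / (totient c)%:R <= C * z%:R * rho R q.
Proof.
have [C C0 hC] := sum_inv_totient_coprime.
exists (9 * C); first by rewrite mulr_gt0.
move=> z q z2 q0 qz; have lz : 0 < ln z%:R :> R by rewrite ln_gt0// ltr1n.
rewrite -(ler_pM2l lz).
pose f c : R := (coprime c q)%:R * (c%:R / (totient c)%:R).
have f0 c : 0 <= f c by rewrite mulr_ge0// divr_ge0.
pose E : R := \sum_(1 <= c < z.+1) f c / c%:R.
have EE : E <= C * ln z%:R * rho R q.
  apply: le_trans (hC z q z2 q0 qz); rewrite [leRHS]big_mkcond/=.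
  apply: ler_sum_nat => c /andP[c0 _]; rewrite /f; case: ifPn => _.
    by rewrite mul1r mulrAC divff ?mul1r// pnatr_eq0; lia.
  by rewrite !mul0r.
rewrite big_mkcond/= (eq_bigr f) => [|c _]; last first.
  by rewrite /f; case: ifP => _; rewrite ?mul1r ?mul0r.
suff h : ln z%:R * \sum_(1 <= i < z.+1) f i <= 9 * (z%:R * E).
  apply: (le_trans h).
  rewrite [leRHS](_ : _ = 9 * (z%:R * (C * ln z%:R * rho R q))); last by ring.
  by rewrite !ler_wpM2l.
(* Write [ln c] as the sum of [mangoldt k] over [c = k * b]. Since [k] is a prime power,
   [f (k * b) <= 2 * f b], and Chebyshev bounds the sum over [k <= z / b] by [4 * z / b]. *)
have flog : \sum_(1 <= c < z.+1) f c * ln c%:R <= 8 * (z%:R * E).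
  rewrite (eq_big_nat _ _ (F2 := fun c => \sum_(1 <= k < z.+1)
     \sum_(1 <= b < z.+1) (c == k * b)%N%:R * (f c * mangoldt R k))); last first.
    move=> c /andP[c0 cz]; rewrite -(@sum_mangoldt_dvd R c z)// mulr_sumr big_mkcond/=.
    apply: eq_big_nat => k /andP[k0 kz]; case: ifPn => [/dvdnP[b cE]|kc].
      rewrite mulnC in cE.
      rewrite (bigD1_seq b)/= ?iota_uniq//; last by rewrite mem_index_iota; nia.
      rewrite cE eqxx mul1r big1 ?addr0// => b' b'b.
      by rewrite eqn_pmul2l// eq_sym (negbTE b'b) mul0r.
    rewrite big1// => b _; case: eqVneq => [cE|_]; last by rewrite mul0r.
    by rewrite cE dvdn_mulr in kc.
  rewrite exchange_big/=.
  under eq_bigr do rewrite exchange_big/=.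
  rewrite exchange_big/= mulrA mulr_sumr.
  apply: ler_sum_nat => b /andP[b0 bz].
  apply: (@le_trans _ _ (2 * f b * chebyshev R (z %/ b))); last first.
    rewrite (_ : 8 * z%:R * (f b / b%:R) = 2 * f b * (4 * (z%:R / b%:R))); last first.
      by field; rewrite pnatr_eq0; lia.
    rewrite ler_wpM2l ?mulr_ge0// (le_trans (chebyshev_le _ _))// ler_wpM2l//.
    by rewrite ler_pdivlMr ?ltr0n// -natrM ler_nat leq_trunc_div.
  rewrite /chebyshev mulr_sumr.
  rewrite [leRHS](_ : _ = \sum_(1 <= k < z.+1 | (k < (z %/ b).+1)%N) 2 * f b * mangoldt R k); last first.
    rewrite (big_nat_widen 1 _ z.+1)//; by rewrite ltnS leq_div.
  rewrite [leRHS]big_mkcond/=; apply: ler_sum_nat => k /andP[k0 kz].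
  have [kb|kb] := ltnP k (z %/ b).+1; last first.
    rewrite big_nat big1// => c /andP[c0 cz]; case: eqVneq => [cE|_]; last by rewrite mul0r.
    move: kb; rewrite ltnNge leq_divRL//; lia.
  rewrite (bigD1_seq (k * b)%N)/= ?iota_uniq//; last first.
    by move: kb; rewrite mem_index_iota ltnS leq_divRL//; nia.
  rewrite eqxx mul1r big1 ?addr0; last by move=> c /negbTE ->; rewrite mul0r.
  have [->|mk] := eqVneq (mangoldt R k) 0; first by rewrite !mulr0.
  rewrite ler_wpM2r ?mangoldt_ge0//.
  have [p [a [pp a0 kE]]] := mangoldt_neq0 mk.
  rewrite /f coprimeMl; case: (boolP (coprime k q)) => _; last by rewrite !mul0r !mulr_ge0.
  rewrite /= [leRHS]mulrCA ler_wpM2l//.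
  have tb : (0 < totient b)%N by rewrite totient_gt0.
  have tkb : (0 < totient (k * b))%N by rewrite totient_gt0 muln_gt0 k0.
  rewrite mulrA ler_pdivrMr ?ltr0n// [leRHS]mulrAC ler_pdivlMr ?ltr0n//.
  rewrite -!natrM ler_nat.
  by have := totient_pfactorM_ge b pp a0; rewrite -kE; nia.
(* Here [ln (z / c) < z / c]. *)
have flow : \sum_(1 <= c < z.+1) f c * (ln z%:R - ln c%:R) <= z%:R * E.
  rewrite mulr_sumr; apply: ler_sum_nat => c /andP[c0 cz].
  rewrite mulrCA ler_wpM2l// -ln_div ?posrE ?ltr0n//; last by lia.
  by apply/ltW/ln_sublinear; rewrite divr_gt0 ?ltr0n//; lia.
rewrite mulr_sumr.
rewrite (eq_bigr (fun c => f c * (ln z%:R - ln c%:R) + f c * ln c%:R)); last first.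
  by move=> c _; ring.
rewrite big_split/=; lra.
Qed.

End CoprimeSums.

(** * Pairs of reduced fractions at a given distance *)

Section Crt.
Local Open Scope nat_scope.

Lemma sum_crt (N M : nat) (Q S : nat -> nat) : 0 < N -> 0 < M -> coprime N M ->
  \sum_(0 <= t < N * M) Q (t %% N) * S (t %% M) =
  (\sum_(0 <= i < N) Q i) * (\sum_(0 <= j < M) S j).
Proof.
move=> N0 M0 coNM; rewrite !big_mkord big_distrlr/= pair_big/=.
pose h (t : 'I_(N * M)) : 'I_N * 'I_M :=
  (Ordinal (ltn_pmod t N0), Ordinal (ltn_pmod t M0)).
have h_inj : injective h.
  move=> s t [/eqP sN /eqP sM]; apply/val_inj => /=.
  have : s == t %[mod N * M] by rewrite chinese_remainder// sN.
  by rewrite !modn_small// => /eqP.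
by rewrite [RHS](reindex h)//; apply/onW_bij/inj_card_bij;
   rewrite // card_prod !card_ord.
Qed.

Lemma sum_periodic (P k : nat) (F : nat -> nat) : (forall t, F (t + P) = F t) ->
  \sum_(0 <= t < k * P) F t = k * \sum_(0 <= t < P) F t.
Proof.
move=> FP; elim: k => [|k IH]; first by rewrite big_geq.
rewrite (@big_cat_nat _ _ _ (k * P))//=; last by rewrite leq_mul2r leqnSn orbT.
rewrite IH -[in X in _ + X](add0n (k * P)) big_addn mulSn addnK addnC; congr (_ + _).
apply: eq_bigr => t _; elim: k {IH} => [|k IHk]; first by rewrite addn0.
by have -> : t + k.+1 * P = t + k * P + P by [rewrite mulSn; lia]; rewrite FP.
Qed.

(** The condition at [p] depends only on [t] modulo [p], so by Chinese remainders the conditions are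
    independent over a full period. *)
Lemma sum_sieve (s : seq nat) (G : nat -> nat -> bool) :
  uniq s -> all prime s -> (forall p t, p \in s -> G p (t %% p) = G p t) ->
  \sum_(0 <= t < \prod_(p <- s) p) all (G^~ t) s =
  \prod_(p <- s) \sum_(0 <= t < p) G p t.
Proof.
elim: s => [_ _ _|p s IH /= /andP[ps us] /andP[pp sp] Gp].
  by rewrite !big_nil big_nat1.
rewrite !big_cons -IH//; last by move=> q t qs; apply: Gp; rewrite inE qs orbT.
have P0 : 0 < \prod_(q <- s) q.
  by rewrite big_seq prodn_cond_gt0// => q qs; rewrite prime_gt0 ?(allP sp).
have coP : coprime p (\prod_(q <- s) q).
  rewrite big_seq; elim/big_ind: _ => [|x y cx cy|q qs]; first exact: coprimen1.
    by rewrite coprimeMr cx.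
  rewrite prime_coprime// dvdn_prime2 ?(allP sp _ qs)//.
  by apply: contraNN ps => /eqP ->.
rewrite -[RHS](sum_crt (fun t => G p t) (fun t => all (G^~ t) s) (prime_gt0 pp) P0 coP).
apply: eq_bigr => t _; rewrite Gp ?inE ?eqxx// mulnb; congr (nat_of_bool (_ && _)).
apply/eq_in_all => q qs; have Gq u : G q (u %% q) = G q u by apply: Gp; rewrite inE qs orbT.
rewrite -[LHS]Gq -[RHS]Gq modn_dvdm//.
by rewrite (big_rem q)//= dvdn_mulr.
Qed.

Lemma exists_dvd_affine (p a m : nat) : prime p -> ~~ (p %| m) ->
  exists2 t, t < p & p %| a + t * m.
Proof.
move=> pp pm; have m0 : 0 < m by case: m pm => //; rewrite dvdn0.
have p0 := prime_gt0 pp.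
have co : coprime p m by rewrite prime_coprime.
pose u := (chinese m p 1 0).
have um : u = 1 %[mod m] by apply: chinese_modl; rewrite coprime_sym.
have up : p %| u by rewrite /dvdn chinese_modr ?mod0n// coprime_sym.
(* [x] is a multiple of [p] congruent to [a] modulo [m]. The summand [a * p * m] ensures [x >= a],
   so that [(x - a) / m] is a natural number. *)
pose x := a * u + a * p * m.
have xa : a <= x by rewrite /x -mulnA (leq_trans _ (leq_addl _ _))// leq_pmulr// muln_gt0 p0.
have /dvdnP[t tE] : m %| x - a.
  by rewrite -eqn_mod_dvd// /x addnC modnMDl -modnMmr um modnMmr muln1.
exists (t %% p); first by rewrite ltn_pmod.
rewrite /dvdn -modnDmr modnMml modnDmr -tE subnKC// -/(dvdn p x) /x.
by rewrite dvdn_add ?[a * p * m]mulnAC ?dvdn_mull.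
Qed.

Lemma sum_good_le1 (p : nat) (g : pred nat) (t : nat) : t < p -> ~~ g t ->
  \sum_(0 <= i < p) g i <= p.-1.
Proof.
move=> tp gt; rewrite big_mkord (bigD1 (Ordinal tp))//= (negbTE gt) add0n.
apply: (@leq_trans (\sum_(i < p | i != Ordinal tp) 1)).
  by apply: leq_sum => i _; exact: leq_b1.
rewrite sum1_card; have := cardC1 (Ordinal tp); rewrite card_ord => <-.
by apply/eq_leq/eq_card => i; rewrite !inE.
Qed.

Lemma sum_good_le2 (p : nat) (g : pred nat) (t u : nat) : t < p -> u < p ->
  t != u -> ~~ g t -> ~~ g u -> \sum_(0 <= i < p) g i <= p.-2.
Proof.
move=> tp up tu gt gu; rewrite big_mkord (bigD1 (Ordinal tp))//= (negbTE gt) add0n.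
rewrite (bigD1 (Ordinal up))/=; last by rewrite -val_eqE/= eq_sym.
rewrite (negbTE gu) add0n.
apply: (@leq_trans (\sum_(i < p | (i != Ordinal tp) && (i != Ordinal up)) 1)).
  by apply: leq_sum => i _; exact: leq_b1.
rewrite sum1_card; have := cardC (pred2 (Ordinal tp) (Ordinal up)).
rewrite card_ord card2 -val_eqE/= tu/= => pE.
move: pE; set n := #|_| => pE; have -> : p.-2 = n by lia.
by apply/eq_leq/eq_card => i; rewrite !inE negb_or.
Qed.

End Crt.

(** * Reduction of the pair count to a sieve *)

Section PairCount.
Local Open Scope nat_scope.

(* The number of pairs of reduced fractions [a / m], [b / n] in [0, 1[ with
   [a / m - b / n = c / lcm(m, n)], where [m = d m'], [n = d n'] and [d = gcd(m, n)]. *)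
Definition pair_count (d m' n' c : nat) : nat :=
  \sum_(0 <= a < d * m') \sum_(0 <= b < d * n')
    [&& coprime a (d * m'), coprime b (d * n') & a * n' == b * m' + c].

Lemma pair_count_gt0 (d m' n' c : nat) : 0 < pair_count d m' n' c ->
  exists a b, [/\ a < d * m', b < d * n', coprime a (d * m'), coprime b (d * n') &
    a * n' = b * m' + c].
Proof.
rewrite /pair_count lt0n => h.
have [/existsP[a /existsP[b /and3P[ca cb /eqP e]]]|] :=
    boolP [exists a : 'I_(d * m'), exists b : 'I_(d * n'),
    [&& coprime a (d * m'), coprime b (d * n') & a * n' == b * m' + c]].
  by exists a, b; rewrite !ltn_ord.
rewrite negb_exists => /forallP nab; case/negP: h.
rewrite big_mkord big1// => a _; rewrite big_mkord big1// => b _.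
by have := nab a; rewrite negb_exists => /forallP/(_ b) /negbTE ->.
Qed.

Lemma pair_count_coprime (d m' n' c : nat) : coprime m' n' ->
  0 < pair_count d m' n' c -> coprime c (m' * n').
Proof.
move=> co /pair_count_gt0[a [b [_ _ ca cb e]]]; rewrite coprimeMr.
apply/andP; split; rewrite /coprime -dvdn1.
  have ga : gcdn c m' %| a.
    rewrite -(@Gauss_dvdl _ _ n'); last first.
      exact: coprime_dvdl (dvdn_gcdr _ _) co.
    by rewrite e dvdn_add ?dvdn_gcdl// dvdn_mull// dvdn_gcdr.
  move: ca; rewrite /coprime -dvdn1; apply: dvdn_trans.
  by rewrite dvdn_gcd ga dvdn_mull// dvdn_gcdr.
have gb : gcdn c n' %| b.
  rewrite -(@Gauss_dvdl _ _ m'); last first.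
    by rewrite (coprime_dvdl (dvdn_gcdr _ _))// coprime_sym.
  by rewrite -(@dvdn_addl c) ?dvdn_gcdl// -e dvdn_mull// dvdn_gcdr.
move: cb; rewrite /coprime -dvdn1; apply: dvdn_trans.
by rewrite dvdn_gcd gb dvdn_mull// dvdn_gcdr.
Qed.

(** The solutions of [a * n' = b * m' + c] lie in one progression [(a0 + t * m', b0 + t * n')], and
    [a < d * m'] forces [t < d]. Coprimality to the denominators implies that no prime of [d]
    divides either coordinate. *)
Lemma pair_count_le_sieve (d m' n' c : nat) : 0 < d -> 0 < m' -> 0 < n' ->
  coprime m' n' -> 0 < pair_count d m' n' c ->
  exists a0 b0, a0 * n' = b0 * m' + c /\
    pair_count d m' n' c <= \sum_(0 <= t < d)
      all (fun p => ~~ (p %| a0 + t * m') && ~~ (p %| b0 + t * n')) (primes d).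
Proof.
move=> d0 m0 n0 co /pair_count_gt0[a1 [b1 [a1m b1n _ _ e1]]].
(* [a0] is chosen as the least first coordinate of a solution, so that every solution is reached
   with [t >= 0]. *)
pose P a := [exists b : 'I_(d * n'), a * n' == b * m' + c].
have exP : exists a, P a by exists a1; apply/existsP; exists (Ordinal b1n); apply/eqP.
have /existsP[b0 /eqP e0] : P (ex_minn exP) by case: ex_minnP.
have min_a0 a : P a -> ex_minn exP <= a by case: ex_minnP => a0 _; exact.
move: (ex_minn exP) e0 min_a0 => a0 e0 min_a0.
exists a0, b0; split => //; rewrite /pair_count.
pose good t := all (fun p => ~~ (p %| a0 + t * m') && ~~ (p %| b0 + t * n')) (primes d).
apply: (@leq_trans (\sum_(0 <= a < d * m') \sum_(0 <= b < d * n')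
    \sum_(0 <= t < d) (a == a0 + t * m') && (b == b0 + t * n') * good t)); last first.
  under eq_bigr do rewrite exchange_big/=.
  rewrite exchange_big/=; apply: leq_sum => t _.
  apply: (@leq_trans (\sum_(0 <= a < d * m') (a == a0 + t * m') * good t)).
    apply: leq_sum => a _; case: eqP => _; last by rewrite big1.
    rewrite -big_distrl/= leq_mul2r; apply/orP; right.
    have [bn|bn] := ltnP (b0 + t * n') (d * n').
      rewrite big_mkord (bigD1 (Ordinal bn))//= eqxx big1// => b.
      by rewrite -val_eqE/= => /negbTE ->.
    rewrite big_nat big1// => b /andP[_ bn']; case: eqP => // bE; lia.
  rewrite -big_distrl/= -[leqRHS]mul1n leq_mul2r; apply/orP; right.
  have [bn|bn] := ltnP (a0 + t * m') (d * m').
    rewrite big_mkord (bigD1 (Ordinal bn))//= eqxx big1// => b.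
    by rewrite -val_eqE/= => /negbTE ->.
  rewrite big_nat big1// => b /andP[_ bn']; case: eqP => // bE; lia.
rewrite big_nat [leqRHS]big_nat; apply: leq_sum => a /andP[_ am].
rewrite big_nat [leqRHS]big_nat; apply: leq_sum => b /andP[_ bn].
case: (boolP [&& _, _ & _]) => // /and3P[ca cb /eqP e].
have a0a : a0 <= a.
  by apply: min_a0; apply/existsP; exists (Ordinal bn); apply/eqP.
have b0b : b0 <= b.
  by rewrite -(leq_pmul2r m0) -(leq_add2r c) -e0 -e leq_pmul2r.
have /dvdnP[t tE] : m' %| a - a0.
  rewrite -(@Gauss_dvdl _ _ n')// mulnBl e e0 subnDr -mulnBl; exact: dvdn_mull.
have aE : a = a0 + t * m' by lia.
have bE : b = b0 + t * n'.
  apply/eqP; rewrite -(eqn_pmul2r m0) mulnDl; apply/eqP.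
  by move: e; rewrite aE mulnDl e0; lia.
have td : t < d by rewrite -(ltn_pmul2r m0) -tE; lia.
rewrite big_mkord (bigD1 (Ordinal td))//= -aE -bE !eqxx/=.
suff -> : good t by [].
apply/allP => p; rewrite mem_primes => /and3P[pp _ pd]; rewrite -aE -bE.
apply/andP; split; apply/negP => pa.
  have : p %| gcdn a (d * m') by rewrite dvdn_gcd pa dvdn_mulr.
  by rewrite (eqP ca) dvdn1 => /eqP p1; rewrite p1 in pp.
have : p %| gcdn b (d * n') by rewrite dvdn_gcd pa dvdn_mulr.
by rewrite (eqP cb) dvdn1 => /eqP p1; rewrite p1 in pp.
Qed.

Lemma prod_primes_dvd (d : nat) : 0 < d -> \prod_(p <- primes d) p %| d.
Proof.
move=> d0; rewrite [X in _ %| X](prod_prime_decomp d0) prime_decompE big_map/=.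
rewrite big_seq [X in _ %| X]big_seq.
elim/big_rec2: _ => // p x y pd yx; apply: dvdn_mul => //.
by rewrite dvdn_exp// logn_gt0.
Qed.

End PairCount.

Section PairBound.
Variable R : realType.

Lemma rho_bounded_prod (n N : nat) : (0 < n)%N -> (n < N)%N ->
  rho R n = \prod_(0 <= p < N) (if prime p && (p %| n)%N then 1 - p%:R^-1 else 1).
Proof.
move=> n0 nN; rewrite /rho (big_primes _ _ nN) big_mkcond.
by apply: eq_bigr => p _; rewrite mem_primes n0.
Qed.

(** At least one class of [t] modulo [p] is always excluded. When [p] does not divide [m * n * c]
    two are: if the two excluded classes coincided, [p] would divide [c]. In that case
    [p - 2 <= p * (1 - 1 / p) ^ 2] concludes. *)
Lemma local_density_le (p a b m n c : nat) : prime p -> coprime m n ->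
  (a * n = b * m + c)%N ->
  (\sum_(0 <= t < p) (~~ (p %| a + t * m)%N && ~~ (p %| b + t * n)%N))%:R <=
  p%:R * ((1 - p%:R^-1) * (if (p %| m * n * c)%N then 1 else 1 - p%:R^-1)) :> R.
Proof.
move=> pp co e; have p2 := prime_gt1 pp; have p0 := prime_gt0 pp.
have p0R : (0 : R) < p%:R by rewrite ltr0n.
have pred1 : p.-1%:R = p%:R * (1 - p%:R^-1) :> R.
  by rewrite -subn1 natrB// mulrBr mulr1 divff ?gt_eqF.
have [pmn|] := boolP (p %| m * n * c)%N.
  rewrite mulr1 -pred1 ler_nat.
  have [pm|pm] := boolP (p %| m)%N.
    have pn : ~~ (p %| n)%N.
      apply/negP => pn; have : (p %| gcdn m n)%N by rewrite dvdn_gcd pm.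
      by rewrite (eqP co) dvdn1 => /eqP p1; rewrite p1 in pp.
    have [t tp pt] := exists_dvd_affine b pp pn.
    by apply: (sum_good_le1 tp); rewrite pt andbF.
  have [t tp pt] := exists_dvd_affine a pp pm.
  by apply: (sum_good_le1 tp); rewrite pt.
rewrite !Euclid_dvdM// !negb_or => /andP[/andP[pm pn] pc].
have [t tp pt] := exists_dvd_affine a pp pm.
have [u up pu] := exists_dvd_affine b pp pn.
have tu : t != u.
  apply: contraNneq pc => tu; rewrite -tu in pu.
  have h : (p %| (b + t * n) * m + c)%N.
    have -> : ((b + t * n) * m + c = (a + t * m) * n)%N by rewrite !mulnDl e; lia.
    exact: dvdn_mulr.
  by move: h; rewrite dvdn_addr// dvdn_mulr.
apply: (@le_trans _ _ p.-2%:R).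
  by rewrite ler_nat; apply: (sum_good_le2 tp up tu); rewrite ?pt ?pu ?andbF.
have -> : p.-2%:R = p%:R - 2 :> R by rewrite -subn2 natrB.
have px : p%:R * p%:R^-1 = 1 :> R by rewrite divff ?gt_eqF.
rewrite [leRHS](_ : _ = p%:R - 2 * (p%:R * p%:R^-1) + p%:R * p%:R^-1 * p%:R^-1); last by ring.
have : 0 <= p%:R^-1 :> R by rewrite invr_ge0.
rewrite px; lra.
Qed.

(* With [mu p = 1 - 1/p], a prime [p | d] contributes [mu p] or, when it does not divide
   [m' n' c], [mu p ^ 2]; the quotient of [rho]s on the right has at each prime an
   exponent at most that large. *)
Lemma pair_count_le (d m' n' c : nat) :
  (0 < d)%N -> (0 < m')%N -> (0 < n')%N -> (0 < c)%N -> coprime m' n' ->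
  (pair_count d m' n' c)%:R <=
  (coprime c (m' * n'))%:R * (d%:R * (rho R (d * m') * rho R (d * n')) /
    (rho R (m' * n') * rho R c)).
Proof.
move=> d0 m0 n0 c0 co.
have [->|] := posnP (pair_count d m' n' c).
  by rewrite mulr_ge0// divr_ge0// ?mulr_ge0//; exact/ltW/rho_gt0.
move=> r0; have coc := pair_count_coprime co r0.
rewrite coc mul1r; have {r0} [a0 [b0 [e]]] := pair_count_le_sieve d0 m0 n0 co r0.
rewrite -(ler_nat R) => /le_trans; apply.
pose G p t := ~~ (p %| a0 + t * m')%N && ~~ (p %| b0 + t * n')%N.
pose P := (\prod_(p <- primes d) p)%N.
have GP p t : G p (t %% p)%N = G p t.
  by rewrite /G /dvdn -modnDmr modnMml modnDmr -[X in _ && ~~ (X == _)]modnDmr modnMml modnDmr.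
(* The range [t < d] consists of [k] full periods of the radical [P] of [d], so the sieve count
   factors exactly into local counts. *)
have /dvdnP[k dE] := prod_primes_dvd d0.
have -> : (\sum_(0 <= t < d) all (fun p => G p t) (primes d))%N =
          (k * \prod_(p <- primes d) \sum_(0 <= t < p) G p t)%N.
  rewrite -sum_sieve ?primes_uniq ?all_prime_primes//.
  rewrite -/P in dE *; set s := primes d; rewrite [in X in (X = _)%N]dE -sum_periodic// => t.
  congr nat_of_bool; apply: eq_in_all => p pd; rewrite -[LHS]GP -[RHS]GP.
  have /dvdnP[j ->] : (p %| P)%N by rewrite /P (big_rem p)//= dvdn_mulr.
  by rewrite addnC modnMDl.
pose g p : R := (1 - p%:R^-1) * (if (p %| m' * n' * c)%N then 1 else 1 - p%:R^-1).
have x_bound p : prime p -> 2^-1 <= 1 - p%:R^-1 :> R /\ 1 - p%:R^-1 < 1 :> R.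
  by move=> pp; have [] := prime_inv R pp; split; lra.
apply: (@le_trans _ _ (d%:R * \prod_(p <- primes d) g p)).
  rewrite [in X in _ <= X%:R * _]dE !natrM -mulrA ler_wpM2l//.
  rewrite /P natr_prod natr_prod -big_split/= big_seq [leRHS]big_seq.
  apply: ler_prod => p; rewrite mem_primes => /andP[pp _]; rewrite ler0n/=.
  exact: local_density_le.
rewrite -[leRHS]mulrA ler_wpM2l// ler_pdivlMr ?mulr_gt0 ?rho_gt0//.
pose N := (d * m' * n' * c).+1.
have dm0 : (0 < d * m')%N by rewrite muln_gt0 d0.
have dn0 : (0 < d * n')%N by rewrite muln_gt0 d0.
have mn0 : (0 < m' * n')%N by rewrite muln_gt0 m0.
rewrite !(@rho_bounded_prod _ N)//; try (rewrite ltnS /N; nia).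
have dN : (d < N)%N by rewrite ltnS; nia.
rewrite (big_primes _ _ dN) big_mkcond -!big_split/=.
apply: ler_prod => p _; rewrite mem_primes d0/= /g.
have [pp|//] := boolP (prime p); last by rewrite /= !mul1r lexx ler01.
rewrite /= !Euclid_dvdM//.
have [x1 x2] := x_bound p pp.
have co_mn : ~~ ((p %| m')%N && (p %| n')%N).
  apply/negP => /andP[pm pn]; have : (p %| gcdn m' n')%N by rewrite dvdn_gcd pm.
  by rewrite (eqP co) dvdn1 => /eqP p1; rewrite p1 in pp.
have co_c : ~~ ((p %| c)%N && ((p %| m')%N || (p %| n')%N)).
  rewrite -Euclid_dvdM//.
  apply/negP => /andP[pm pn]; have : (p %| gcdn c (m' * n'))%N by rewrite dvdn_gcd pm.
  by rewrite (eqP coc) dvdn1 => /eqP p1; rewrite p1 in pp.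
(* Only a number [x] in [[1/2, 1)] and four divisibilities by [p] remain; each pattern allowed by
   coprimality is a comparison of powers of [x]. *)
move: (1 - p%:R^-1) x1 x2 => x x1 x2.
move: (p %| d)%N (p %| m')%N (p %| n')%N (p %| c)%N co_mn co_c => [] [] [] [] //= _ _;
  apply/andP; split; nra.
Qed.

End PairBound.

(** * Averaging close pairs over dyadic scales *)

Section ScaleSum.
Variable R : realType.

Lemma sum_pow2_lt (K : nat) (x : R) : 0 <= x ->
  \sum_(0 <= k < K) 2 ^+ k * (2 ^+ k < x)%R%:R <= 2 * x.
Proof.
(* The second bound carries the induction: when [2 ^ K < x] is added, the earlier terms total at
   most [2 ^ K]. *)
move=> x0; suff h : \sum_(0 <= k < K) 2 ^+ k * (2 ^+ k < x)%R%:R <= 2 * x /\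
    \sum_(0 <= k < K) 2 ^+ k * (2 ^+ k < x)%R%:R <= 2 ^+ K :> R by case: h.
elim: K => [|K [IH1 IH2]]; first by rewrite !big_geq// expr0 mulr_ge0.
rewrite !big_nat_recr//= exprS; case: ltP => h; rewrite ?mulr1 ?mulr0; split; lra.
Qed.

Lemma ler_sum_nat_support (a N M : nat) (F G : nat -> R) :
  (forall c, (a <= c < N)%N -> F c = 0 \/ (c < M)%N /\ F c <= G c) ->
  (forall c, (a <= c < M)%N -> 0 <= G c) ->
  \sum_(a <= c < N) F c <= \sum_(a <= c < M) G c.
Proof.
move=> FG G0; rewrite (big_nat_widen a N (N + M))// ?leq_addr//.
rewrite (big_nat_widen a M (N + M))// ?leq_addl//.
rewrite big_mkcond [leRHS]big_mkcond/=; apply: ler_sum_nat => c /andP[ac _].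
case: ifPn => cN; last by case: ifPn => // cM; rewrite G0// ac.
have /FG [->|[-> //]] : (a <= c < N)%N by rewrite ac.
by case: ifPn => // cM; rewrite G0// ac.
Qed.

(* At the scales with [Y / 2 ^ k >= H] the sieve bound applies to each inner sum; at the
   others [c < H], and the sum over [k] is done first, leaving a logarithmic sum. *)
Lemma sum_scales_coprime : exists2 C : R, 0 < C & forall (H K N q : nat) (Y : R),
  (2 <= H)%N -> (0 < q)%N -> (size (primes q) <= 2 * H)%N -> 0 <= Y ->
  \sum_(0 <= k < K) 2 ^+ k *
     (\sum_(1 <= c < N) (2 ^+ k * c%:R < Y)%R%:R * ((coprime c q)%:R / rho R c)) <=
  C * (K%:R + ln H%:R) * Y * rho R q.
Proof.
have [C1 C1_gt0 hC1] := sum_inv_totient_coprime R.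
have [C2 C2_gt0 hC2] := sum_coprime_div_totient R.
exists (C2 + 2 * C1); first by rewrite addr_gt0 ?mulr_gt0.
move=> H K N q Y H2 q0 qH Y0.
pose f c : R := (coprime c q)%:R / rho R c.
have f0 c : 0 <= f c by rewrite divr_ge0// ltW// rho_gt0.
have fE c : (0 < c)%N -> f c = (coprime c q)%:R * (c%:R / (totient c)%:R).
  move=> c0; rewrite /f totient_rho// invfM [c%:R * _]mulrA divff ?mul1r//.
  by rewrite pnatr_eq0 -lt0n.
have p2 k : 0 < 2 ^+ k :> R by rewrite exprn_gt0.
have step k : 2 ^+ k * (\sum_(1 <= c < N) (2 ^+ k * c%:R < Y)%R%:R * f c) <=
    C2 * Y * rho R q +
    \sum_(1 <= c < H.+1) f c * (2 ^+ k * (2 ^+ k < Y / c%:R)%R%:R).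
  have [YH|YH] := leP (H%:R) (Y / 2 ^+ k).
    have Yk0 : 0 <= Y / 2 ^+ k by rewrite divr_ge0// ltW.
    pose z := Num.truncn (Y / 2 ^+ k).
    have /andP[zY Yz] : z%:R <= Y / 2 ^+ k < z.+1%:R by exact: truncn_itv.
    have Hz : (H <= z)%N by rewrite -ltnS -(ltr_nat R) (le_lt_trans YH).
    have h : \sum_(1 <= c < N) (2 ^+ k * c%:R < Y)%R%:R * f c <= C2 * z%:R * rho R q.
      apply: le_trans (hC2 z q _ q0 _); try lia.
      rewrite [leRHS]big_mkcond/=.
      rewrite [leRHS](_ : _ = \sum_(1 <= c < z.+1) f c); last first.
        apply: eq_big_nat => c /andP[c0 _]; rewrite fE//.
        by case: ifP => _; rewrite ?mul1r ?mul0r.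
      apply: ler_sum_nat_support => // c /andP[c0 cN].
      case: ltP => h; last by left; rewrite mul0r.
      right; rewrite mul1r; split => //; rewrite -(ltr_nat R) (le_lt_trans _ Yz)//.
      by rewrite ler_pdivlMr// mulrC ltW.
    apply: (@le_trans _ _ (C2 * Y * rho R q)); last first.
      rewrite lerDl; apply: sumr_ge0 => c _; rewrite mulr_ge0// mulr_ge0// ltW//.
    apply: (@le_trans _ _ (2 ^+ k * (C2 * z%:R * rho R q))); first by rewrite ler_pM2l.
    rewrite ler_pdivlMr// in zY.
    have rq := rho_gt0 R q.
    rewrite [leLHS](_ : _ = C2 * rho R q * (z%:R * 2 ^+ k)); last by ring.
    rewrite [leRHS](_ : _ = C2 * rho R q * Y); last by ring.
    by rewrite ler_wpM2l// mulr_ge0// ltW.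
  rewrite -[leLHS]add0r lerD//; first by rewrite !mulr_ge0// ltW// rho_gt0.
  rewrite mulr_sumr; apply: ler_sum_nat_support => [c /andP[c0 cN]|c _]; last first.
    by rewrite mulr_ge0// mulr_ge0// ltW.
  have cE : (2 ^+ k < Y / c%:R) = (2 ^+ k * c%:R < Y) by rewrite ltr_pdivlMr ?ltr0n.
  rewrite cE; case: ltP => h; last by left; rewrite mul0r mulr0.
  right; rewrite mulr1 mul1r mulrC; split => //.
  rewrite ltnS -(ler_nat R) ltW// (le_lt_trans _ YH)//.
  by rewrite ler_pdivlMr// mulrC ltW.
apply: (le_trans (ler_sum_nat (fun k _ => step k))).
rewrite big_split/= sumr_const_nat subn0 exchange_big/=.
have -> : C2 * Y * rho R q *+ K = C2 * K%:R * Y * rho R q.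
  by rewrite -mulr_natr; ring.
have h : \sum_(1 <= c < H.+1) \sum_(0 <= k < K) f c * (2 ^+ k * (2 ^+ k < Y / c%:R)%R%:R)
   <= 2 * Y * (C1 * ln H%:R * rho R q).
  apply: (@le_trans _ _ (2 * Y * \sum_(1 <= c < H.+1) f c / c%:R)).
    rewrite mulr_sumr; apply: ler_sum_nat => c /andP[c0 _].
    rewrite -mulr_sumr [leRHS](_ : _ = f c * (2 * (Y / c%:R))); last by ring.
    by rewrite ler_wpM2l// sum_pow2_lt// divr_ge0.
  rewrite ler_wpM2l ?mulr_ge0//; apply: le_trans (hC1 H q H2 q0 qH).
  rewrite [leRHS]big_mkcond/=; apply: ler_sum_nat => c /andP[c0 _]; rewrite fE//.
  case: ifPn => _; last by rewrite !mul0r.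
  by rewrite mul1r mulrAC divff ?mul1r// pnatr_eq0 -lt0n.
have lH : 0 <= ln H%:R :> R by rewrite ln_ge0// ler1n; lia.
have e1 : 0 <= C2 * ln H%:R * Y * rho R q by rewrite !mulr_ge0// ltW// rho_gt0.
have e2 : 0 <= 2 * C1 * K%:R * Y * rho R q by rewrite !mulr_ge0// ltW// rho_gt0.
rewrite (_ : (C2 + 2 * C1) * (K%:R + ln H%:R) * Y * rho R q =
  C2 * K%:R * Y * rho R q + 2 * Y * (C1 * ln H%:R * rho R q) +
  C2 * ln H%:R * Y * rho R q + 2 * C1 * K%:R * Y * rho R q); last by ring.
lra.
Qed.

(** One-sided, so that the difference of the fractions has a positive numerator; the other order is
    [close_pairs n m]. *)
Definition close_pairs (m n : nat) (eta : R) : nat :=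
  \sum_(0 <= a < m) \sum_(0 <= b < n) [&& coprime a m, coprime b n,
    (b%:R / n%:R < a%:R / m%:R :> R)%R & (a%:R / m%:R < b%:R / n%:R + eta)%R].

(** Sorts the pairs by the numerator [c] of the difference over [d * m' * n']; the bound on [c]
    comes from [a / m < 1]. *)
Lemma close_pairs_le (d m' n' : nat) (eta : R) :
  (0 < d)%N -> (0 < m')%N -> (0 < n')%N ->
  (close_pairs (d * m') (d * n') eta <=
  \sum_(1 <= c < (d * m' * n').+1) (c%:R < eta * (d * m' * n')%:R)%R *
    pair_count d m' n' c)%N.
Proof.
move=> d0 m0 n0; rewrite /close_pairs /pair_count.
under [leqRHS]eq_bigr do rewrite big_distrr/=.
rewrite [leqRHS]exchange_big/= big_nat [leqRHS]big_nat; apply: leq_sum => a /andP[_ am].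
under [leqRHS]eq_bigr do rewrite big_distrr/=.
rewrite [leqRHS]exchange_big/= big_nat [leqRHS]big_nat; apply: leq_sum => b /andP[_ bn].
case: (boolP [&& _, _, _ & _]) => // /and4P[ca cb ab1 ab2].
have d0R : 0 < d%:R :> R by rewrite ltr0n.
have m0R : 0 < m'%:R :> R by rewrite ltr0n.
have n0R : 0 < n'%:R :> R by rewrite ltr0n.
have ab : (b * m' < a * n')%N.
  move: ab1; rewrite ltr_pdivrMr ?natrM ?mulr_gt0// mulrAC ltr_pdivlMr ?mulr_gt0//.
  rewrite (_ : b%:R * _ = d%:R * (b * m')%:R); last by rewrite natrM; ring.
  rewrite (_ : a%:R * _ = d%:R * (a * n')%:R); last by rewrite natrM; ring.
  by rewrite ltr_pM2l// ltr_nat.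
pose c := (a * n' - b * m')%N.
have cE : (a * n' = b * m' + c)%N by rewrite /c; lia.
have cN : c \in index_iota 1 (d * m' * n').+1.
  by rewrite mem_index_iota /c; apply/andP; split; nia.
rewrite (bigD1_seq c cN (iota_uniq _ _))/= ca cb cE eqxx.
suff -> : (c%:R < eta * (d * m' * n')%:R)%R by [].
have -> : c%:R = (a%:R / (d * m')%:R - b%:R / (d * n')%:R) * (d * m' * n')%:R :> R.
  have -> : c%:R = a%:R * n'%:R - b%:R * m'%:R :> R.
    by rewrite -!natrM cE natrD; ring.
  by rewrite !natrM; field; rewrite !gt_eqF.
rewrite ltr_pM2r ?natrM ?mulr_gt0//; move: ab2; rewrite !natrM; lra.
Qed.

(** With [d = gcdn m n] and [q = (m / d) * (n / d)], the factor [D] from [pair_count_le] satisfies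
    [D * Y * rho q = eta * totient m * totient n]: the [rho q] gained by summing over [c] coprime to
    [q] cancels the one in the denominator. Independence would give [K] in place of
    [C * (K + ln H)]. The bound [2 ^ H] on [m] and [n] limits [q] to [2 * H] primes. *)
Lemma sum_close_pairs : exists2 C : R, 0 < C & forall (H K m n : nat) (eta : R),
  (2 <= H)%N -> (0 < m)%N -> (0 < n)%N -> (m < 2 ^ H)%N -> (n < 2 ^ H)%N -> 0 <= eta ->
  \sum_(0 <= k < K) 2 ^+ k * (close_pairs m n (eta / 2 ^+ k))%:R <=
  C * (K%:R + ln H%:R) * eta * (totient m)%:R * (totient n)%:R.
Proof.
have [C C_gt0 hC] := sum_scales_coprime; exists C => // H K m n eta H2 m0 n0 mH nH eta0.
pose d := gcdn m n; pose m' := (m %/ d)%N; pose n' := (n %/ d)%N.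
have d0 : (0 < d)%N by rewrite gcdn_gt0 m0.
have mE : m = (d * m')%N by rewrite mulnC divnK// dvdn_gcdl.
have nE : n = (d * n')%N by rewrite mulnC divnK// dvdn_gcdr.
have m'0 : (0 < m')%N by nia.
have n'0 : (0 < n')%N by nia.
have co : coprime m' n'.
  have : gcdn (d * m') (d * n') = (d * 1)%N by rewrite -mE -nE muln1.
  by rewrite -muln_gcdr => /eqP; rewrite eqn_pmul2l.
rewrite !totient_rho//; clearbody m' n'; clearbody d; subst m n.
move: m' n' m'0 n'0 co m0 n0 mH nH => m n m0 n0 co dm0 dn0 mH nH.
pose q := (m * n)%N; have q0 : (0 < q)%N by rewrite muln_gt0 m0.
have qH : (size (primes q) <= 2 * H)%N.
  rewrite -(@leq_exp2l 2)// (leq_trans (size_primes q0))// mulnC expnM.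
  rewrite -mulnn /q leq_mul//; apply: ltnW.
    by rewrite (leq_ltn_trans _ mH)// leq_pmull.
  by rewrite (leq_ltn_trans _ nH)// leq_pmull.
pose L := (d * m * n)%N; pose Y := eta * L%:R.
have Y0 : 0 <= Y by rewrite mulr_ge0.
pose D := d%:R * (rho R (d * m) * rho R (d * n)) / rho R q.
have D0 : 0 <= D by rewrite divr_ge0 ?mulr_ge0//; exact/ltW/rho_gt0.
have step k : (close_pairs (d * m) (d * n) (eta / 2 ^+ k))%:R <=
   D * \sum_(1 <= c < L.+1) (2 ^+ k * c%:R < Y)%R%:R * ((coprime c q)%:R / rho R c).
  have := close_pairs_le (eta / 2 ^+ k) d0 m0 n0.
  rewrite -(ler_nat R) => /le_trans; apply.
  rewrite natr_sum mulr_sumr; apply: ler_sum_nat => c /andP[c0 _].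
  have -> : (c%:R < eta / 2 ^+ k * L%:R) = (2 ^+ k * c%:R < Y).
    by rewrite mulrAC ltr_pdivlMr ?exprn_gt0// mulrC.
  rewrite natrM mulrCA ler_wpM2l// (le_trans (pair_count_le R d0 m0 n0 c0 co))//.
  by rewrite /D -/q invfM le_eqVlt; apply/orP; left; apply/eqP; ring.
apply: (@le_trans _ _ (D * (C * (K%:R + ln H%:R) * Y * rho R q))).
  apply: le_trans (ler_wpM2l D0 (hC H K L.+1 q Y H2 q0 qH Y0)).
  rewrite mulr_sumr; apply: ler_sum_nat => k _.
  by rewrite mulrCA ler_wpM2l// exprn_ge0.
rewrite le_eqVlt; apply/orP; left; apply/eqP.
rewrite /D /Y /L !natrM; field; rewrite gt_eqF//; exact: rho_gt0.
Qed.

End ScaleSum.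

(** * Measure of a union of arcs *)

Section SecondMoment.
Variable R : realType.

(* On [U] use [2 t F <= 1 + (t F)^2] with [F] the number of [A i] containing the
   point. *)
Lemma second_moment (d : measure_display) (T : measurableType d)
    (mu : {measure set T -> \bar R}) (I : eqType) (s : seq I) (A : I -> set T)
    (U : set T) (t : R) : 0 <= t -> measurable U ->
  (forall i, measurable (A i)) -> (forall i, i \in s -> A i `<=` U) ->
  ((2 * t)%:E * \sum_(i <- s) mu (A i) <=
   mu U + (t ^+ 2)%:E * \sum_(i <- s) \sum_(j <- s) mu (A i `&` A j))%E.
Proof.
move=> t0 mU mA AU.
have mind (B : set T) : measurable B -> measurable_fun [set: T] (EFin \o (\1_B : T -> R)).
  by move=> mB; apply/measurable_EFinP; exact: measurable_indic.
have ind0 (B : set T) x : (0 <= (\1_B x : R)%:E)%E by rewrite lee_fin.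
have msum (J : eqType) (r : seq J) (B : J -> set T) : (forall j, measurable (B j)) ->
    measurable_fun [set: T] (fun x => \sum_(j <- r) (\1_(B j) x : R)%:E)%E.
  by move=> mB; apply: emeasurable_sum => j; exact: mind.
have int_sum (J : eqType) (r : seq J) (B : J -> set T) : (forall j, measurable (B j)) ->
    (\int[mu]_x \sum_(j <- r) (\1_(B j) x : R)%:E = \sum_(j <- r) mu (B j))%E.
  move=> mB; rewrite ge0_integral_sum//; last by move=> j; exact: mind.
  by apply: eq_bigr => j _; rewrite integral_indic// setIT.
have sum0 (J : eqType) (r : seq J) (B : J -> set T) x :
    (0 <= \sum_(j <- r) (\1_(B j) x : R)%:E)%E by exact: sume_ge0.
have mA2 (ij : I * I) : measurable (A ij.1 `&` A ij.2) by exact: measurableI.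
have -> : (\sum_(i <- s) \sum_(j <- s) mu (A i `&` A j) =
    \sum_(ij <- [seq (i, j) | i <- s, j <- s]) mu (A ij.1 `&` A ij.2))%E.
  by rewrite big_allpairs_dep.
have -> : mu U = (\int[mu]_x (\1_U x : R)%:E)%E by rewrite integral_indic// setIT.
rewrite -!int_sum// -!ge0_integralZl_EFin ?mulr_ge0 ?exprn_ge0//; last 2 first.
- exact: msum.
- exact: msum.
rewrite -ge0_integralD//; last 3 first.
- exact: mind.
- by move=> x _; rewrite mule_ge0// lee_fin exprn_ge0.
- by apply: measurable_funeM; exact: msum.
apply: ge0_le_integral => //.
- by move=> x _; rewrite mule_ge0// lee_fin mulr_ge0.
- by apply: measurable_funeM; exact: msum.
- by apply: emeasurable_funD; [exact: mind|apply: measurable_funeM; exact: msum].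
move=> x _; rewrite !sumEFin -!EFinM -EFinD lee_fin.
rewrite big_allpairs_dep/=.
pose F := \sum_(i <- s) (\1_(A i) x : R).
have -> : \sum_(i <- s) \sum_(j <- s) (\1_(A i `&` A j) x : R) = F ^+ 2.
  rewrite expr2 /F mulr_suml; apply: eq_bigr => i _; rewrite mulr_sumr.
  by apply: eq_bigr => j _; rewrite indicI.
rewrite -/F; have [xU|xU] := boolP (x \in U).
  rewrite indicE xU/=; have := sqr_ge0 (1 - t * F); nra.
have -> : F = 0.
  rewrite /F big_seq big1// => i iS; rewrite indicE.
  case: (boolP (x \in A i)) => // xA; move/negP: xU; case.
  by rewrite inE; apply: (AU i iS); rewrite inE in xA.
by rewrite mulr0 expr0n/= mulr0 addr0 indicE.
Qed.

End SecondMoment.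

Section Overlap.
Variable R : realType.
Notation lambda := (@lebesgue_measure R).

Lemma lebesgue_measure_oo (a b : R) : a <= b -> lambda `]a, b[%classic = (b - a)%:E.
Proof.
move=> ab; rewrite lebesgue_measure_itv/= lte_fin.
by case: ltgtP ab => // -> _; rewrite subrr.
Qed.

Definition window (x u : R) : set R := `]x - u, x + u[%classic.

Lemma measurable_window (x u : R) : measurable (window x u).
Proof. exact: measurable_itv. Qed.

Lemma overlap_le (x y u v : R) (J : set R) : 0 <= u -> 0 <= v -> measurable J ->
  (lambda ((window x u `&` J) `&` (window y v `&` J)) <=
   (2 * Num.min u v * (`|x - y| < u + v)%R%:R)%R%:E)%E.
Proof.
move=> u0 v0 mJ; have mI := measurable_window.
have mIJ : measurable ((window x u `&` J) `&` (window y v `&` J)).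
  by apply: measurableI; apply: measurableI.
case: (ltP `|x - y| (u + v)) => xy; rewrite ?mulr1 ?mulr0.
  have lx : lambda (window x u) = (2 * u)%:E.
    by rewrite /window lebesgue_measure_oo//; [congr (_%:E); ring|lra].
  have ly : lambda (window y v) = (2 * v)%:E.
    by rewrite /window lebesgue_measure_oo//; [congr (_%:E); ring|lra].
  have [uv|vu] := leP u v.
    rewrite -lx; apply: le_measure; rewrite ?inE//; first exact: mI.
    by move=> z [[]].
  rewrite -ly; apply: le_measure; rewrite ?inE//; first exact: mI.
  by move=> z [_ []].
rewrite (_ : _ `&` _ = set0) ?measure0//; apply/seteqP; split => // z /=.
move=> [[+ _] [+ _]]; rewrite /window/= !in_itv/= => /andP[h1 h2] /andP[h3 h4].
by move: xy; rewrite leNgt ltr_norml; move/negP; apply; apply/andP; split; lra.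
Qed.

(** Cutting at the ends of [[0, 1[] costs at most half of the window: the right half survives for
    [x < 1/2], the left half otherwise. *)
Lemma half_interval_ge (x u : R) : 0 <= x < 1 -> 0 <= u <= 2^-1 ->
  (u%:E <= lambda (window x u `&` `[0%R, 1%R[%classic))%E.
Proof.
move=> /andP[x0 x1] /andP[u0 u1].
have mI : measurable (window x u `&` `[0, 1[%classic).
  by apply: measurableI; [exact: measurable_window|exact: measurable_itv].
have [xh|xh] := ltP x 2^-1.
  rewrite [X in (X%:E <= _)%E](_ : u = (x + u) - x); last by ring.
  rewrite -(@lebesgue_measure_oo x); last by lra.
  apply: le_measure; rewrite ?inE; [exact: measurable_itv|exact: mI|].
move=> z /=; rewrite !in_itv/= => /andP[h1 h2].
  by rewrite /window/= !in_itv/=; split; apply/andP; split; lra.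
rewrite [X in (X%:E <= _)%E](_ : u = x - (x - u)); last by ring.
rewrite -(@lebesgue_measure_oo (x - u)); last by lra.
apply: le_measure; rewrite ?inE; [exact: measurable_itv|exact: mI|].
move=> z /=; rewrite !in_itv/= => /andP[h1 h2].
by rewrite /window/= !in_itv/=; split; apply/andP; split; lra.
Qed.

End Overlap.

(** * Lower bound for the union of the arcs of one block *)

Section BlockMeasure.
Variable R : realType.
Notation lambda := (@lebesgue_measure R).

Lemma exists_le_mean (h : nat) (F : nat -> R) (M : R) :
  (0 < h)%N -> \sum_(0 <= k < h) F k <= h%:R * M ->
  exists2 k, (k < h)%N & F k <= M.
Proof.
move=> h0 FM; apply: contrapT => nk.
have : h%:R * M < \sum_(0 <= k < h) F k.
  have -> : h%:R * M = \sum_(0 <= k < h) M by rewrite sumr_const_nat subn0 mulr_natl.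
  apply: ltr_sum_nat => // k /andP[_ kh]; rewrite ltNge; apply/negP => Fk.
  by apply: nk; exists k.
by rewrite ltNge FM.
Qed.

Lemma sum_coprime_const (n : nat) (x : R) :
  \sum_(0 <= a < n | coprime a n) x = x * (totient n)%:R.
Proof.
rewrite totient_count_coprime natr_sum mulr_sumr big_mkcond/=.
by apply: eq_bigr => a _; rewrite coprime_sym; case: ifP; rewrite ?mulr1 ?mulr0.
Qed.

(** Numerators run from 0 to [n - 1], so that all centres lie in [[0, 1[]; denominator 1 contributes
    the fraction 0. *)
Definition reduced_fractions (s : seq nat) : seq (nat * nat) :=
  [seq (n, a) | n <- s, a <- [seq a <- index_iota 0 n | coprime a n]].

Lemma sum_reduced_fractions (s : seq nat) (F : nat * nat -> R) :
  \sum_(i <- reduced_fractions s) F i =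
  \sum_(n <- s) \sum_(0 <= a < n | coprime a n) F (n, a).
Proof.
rewrite /reduced_fractions big_allpairs_dep/=; apply: eq_bigr => n _.
by rewrite big_filter.
Qed.

Lemma reduced_fractionsP (s : seq nat) (n a : nat) :
  ((n, a) \in reduced_fractions s) = [&& n \in s, (a < n)%N & coprime a n].
Proof.
apply/allpairsPdep/and3P => [[n' [a' [ns + [-> ->]]]]|[ns an co]].
  by rewrite mem_filter mem_index_iota => /and3P[].
by exists n, a; split => //; rewrite mem_filter mem_index_iota co.
Qed.

Lemma reduced_fractions_uniq (s : seq nat) : uniq s -> uniq (reduced_fractions s).
Proof.
move=> us; apply: allpairs_uniq_dep => //.
  by move=> n _; rewrite filter_uniq// iota_uniq.
by move=> [n a] [m b] _ _ /= [-> ->].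
Qed.

Lemma reduced_fraction_inj (m n a b : nat) : (0 < m)%N -> (0 < n)%N ->
  coprime a m -> coprime b n -> a%:R / m%:R = b%:R / n%:R :> R -> (m, a) = (n, b).
Proof.
move=> m0 n0 cam cbn /eqP; rewrite eqr_div ?pnatr_eq0 -?lt0n//.
rewrite -!natrM eqr_nat => /eqP e.
have mn : (m %| n)%N by rewrite -(@Gauss_dvdr _ a) 1?coprime_sym// e dvdn_mull.
have nm : (n %| m)%N by rewrite -(@Gauss_dvdr _ b) 1?coprime_sym// -e dvdn_mull.
have mE : m = n by apply/eqP; rewrite eqn_dvd mn.
rewrite mE in e *; congr pair; apply/eqP.
by rewrite -(eqn_pmul2r n0) e.
Qed.

Lemma close_pairsE (m n : nat) (eta : R) : (close_pairs m n eta)%:R =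
  \sum_(0 <= a < m | coprime a m) \sum_(0 <= b < n | coprime b n)
   ((b%:R / n%:R < a%:R / m%:R :> R) && (a%:R / m%:R < b%:R / n%:R + eta))%:R :> R.
Proof.
rewrite /close_pairs natr_sum [RHS]big_mkcond/=; apply: eq_bigr => a _.
case: ifPn => cam.
  rewrite natr_sum [RHS]big_mkcond/=; apply: eq_bigr => b _.
  by case: ifPn.
by rewrite big1.
Qed.

Section Scale.
Variables (s : seq nat) (delta : nat -> R).
Hypothesis s_uniq : uniq s.
Hypothesis s_gt0 : forall n, n \in s -> (0 < n)%N.
Hypothesis delta_bound : forall n, n \in s -> 0 <= delta n <= 2^-1.

Let S := \sum_(n <- s) delta n * (totient n)%:R.

Definition arc (k : nat) (i : nat * nat) : set R :=
  window (i.2%:R / i.1%:R) (delta i.1 / 2 ^+ k) `&` `[0, 1[%classic.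

Lemma measurable_arc (k : nat) (i : nat * nat) : measurable (arc k i).
Proof. by apply: measurableI; [exact: measurable_window|exact: measurable_itv]. Qed.

Definition overlap_bound (k : nat) : R := 2 * S / 2 ^+ k +
  \sum_(m <- s) \sum_(n <- s) 2 * Num.min (delta m) (delta n) / 2 ^+ k *
    ((close_pairs m n ((delta m + delta n) / 2 ^+ k))%:R +
     (close_pairs n m ((delta m + delta n) / 2 ^+ k))%:R).

(** The diagonal gives the first summand. Off the diagonal the centres are distinct, so exactly one
    order is strict; arcs that meet have centres closer than the sum of the radii, and their
    intersection is no longer than the shorter window. *)
Lemma sum_overlap_le (k : nat) :
  (\sum_(i <- reduced_fractions s) \sum_(j <- reduced_fractions s)
     lambda (arc k i `&` arc k j) <= (overlap_bound k)%:E)%E.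
Proof.
have p2 : 0 < 2 ^+ k :> R by rewrite exprn_gt0.
have mJ : measurable `[0 : R, 1[%classic by exact: measurable_itv.
pose eta m n := (delta m + delta n) / 2 ^+ k.
pose lt_close (i j : nat * nat) : R := ((j.2%:R / j.1%:R < i.2%:R / i.1%:R :> R) &&
   (i.2%:R / i.1%:R < j.2%:R / j.1%:R + eta i.1 j.1))%:R.
pose c m n := 2 * Num.min (delta m) (delta n) / 2 ^+ k.
have c0 m n : m \in s -> n \in s -> 0 <= c m n.
  move=> /delta_bound/andP[m0 _] /delta_bound/andP[n0 _].
  by rewrite divr_ge0 ?(ltW p2)// mulr_ge0// le_min m0.
pose g (i j : nat * nat) : R := (i == j)%:R * (2 * delta i.1 / 2 ^+ k) +
  c i.1 j.1 * (lt_close i j + lt_close j i).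
apply: (@le_trans _ _ (\sum_(i <- reduced_fractions s)
    \sum_(j <- reduced_fractions s) g i j)%:E).
  rewrite -sumEFin big_seq [leRHS]big_seq; apply: lee_sum => -[m a].
  rewrite reduced_fractionsP => /and3P[ms am cam].
  rewrite -sumEFin big_seq [leRHS]big_seq; apply: lee_sum => -[n b].
  rewrite reduced_fractionsP => /and3P[ns bn cbn].
  have /andP[dm0 _] := delta_bound ms; have /andP[dn0 _] := delta_bound ns.
  have um : 0 <= delta m / 2 ^+ k by rewrite divr_ge0// ltW.
  have un : 0 <= delta n / 2 ^+ k by rewrite divr_ge0// ltW.
  apply: le_trans (overlap_le _ _ um un mJ) _; rewrite lee_fin.
  have minE : 2 * Num.min (delta m / 2 ^+ k) (delta n / 2 ^+ k) = c m n.
    by rewrite /c -minr_pMl ?invr_ge0 ?(ltW p2)// mulrA.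
  rewrite minE /g /=; have [mn|mn] := eqVneq (m, a) (n, b).
    have [mE _] : m = n /\ a = b by case: mn.
    rewrite mul1r -[leLHS]addr0 lerD//; last first.
      by rewrite mulr_ge0 ?c0// addr_ge0// /lt_close.
    rewrite /c -mE minxx ler_piMr ?lern1 ?leq_b1//.
    by rewrite divr_ge0 ?(ltW p2)// mulr_ge0.
  rewrite mul0r add0r ler_wpM2l ?c0// /lt_close/=.
  have neq : a%:R / m%:R != b%:R / n%:R :> R.
    by apply: contra mn => /eqP/reduced_fraction_inj ->//; exact: s_gt0.
  rewrite -mulrDl -/(eta m n).
  have [|_] := ltP `|a%:R / m%:R - b%:R / n%:R| (eta m n); last exact: addr_ge0.
  rewrite ltr_norml => /andP[h1 h2].
  move: neq; rewrite neq_lt => /orP[ab|ab].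
    rewrite ab (_ : (_ < _ + eta n m) = true) ?lerDr//.
    by rewrite /eta [delta n + _]addrC -/(eta m n); lra.
  rewrite ab (_ : (_ < _ + eta m n) = true) ?lerDl//; lra.
rewrite lee_fin /overlap_bound.
under eq_bigr do rewrite big_split/=.
rewrite big_split/= lerD//.
  rewrite le_eqVlt; apply/orP; left; apply/eqP.
  rewrite big_seq (eq_bigr (fun i => 2 * delta i.1 / 2 ^+ k)) => [|i ir]; last first.
    rewrite (bigD1_seq i)/= ?reduced_fractions_uniq// eqxx mul1r big1 ?addr0//.
    by move=> j; rewrite eq_sym => /negbTE ->; rewrite mul0r.
  rewrite -big_seq sum_reduced_fractions /S mulr_sumr mulr_suml.
  by apply: eq_bigr => n _; rewrite /= sum_coprime_const; ring.
rewrite sum_reduced_fractions le_eqVlt; apply/orP; left; apply/eqP.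
apply: eq_bigr => m _.
rewrite (eq_bigr (fun a => \sum_(n <- s) \sum_(0 <= b < n | coprime b n)
    c m n * (lt_close (m, a) (n, b) + lt_close (n, b) (m, a)))); last first.
  by move=> a _; rewrite sum_reduced_fractions.
rewrite exchange_big/=; apply: eq_bigr => n _.
rewrite (eq_bigr (fun a => c m n * (\sum_(0 <= b < n | coprime b n) lt_close (m, a) (n, b) +
    \sum_(0 <= b < n | coprime b n) lt_close (n, b) (m, a)))); last first.
  by move=> a _; rewrite -mulr_sumr big_split.
rewrite -mulr_sumr big_split/= !close_pairsE; congr (_ * (_ + _)).
rewrite exchange_big/=; apply: eq_bigr => b _; apply: eq_bigr => a _.
by rewrite /lt_close/= /eta [delta n + _]addrC.
Qed.

End Scale.

(** The first moment at scale [k] is of order [S / 2 ^ k], so the overlaps are weighted by [4 ^ k].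
    By [sum_close_pairs] with [H = 2 ^ h.+1], whose logarithm is at most [2 * h], the weighted
    overlaps average to at most [C' * S ^ 2] over the [h] scales; [S >= 2 ^ h] controls the diagonal
    terms. At a scale not above the mean, the second moment inequality gives [1 / C']. *)
Lemma block_measure : exists2 c0 : R, 0 < c0 &
  forall (h : nat) (s : seq nat) (delta : nat -> R) (V : set R),
  (0 < h)%N -> uniq s -> (forall n, n \in s -> (0 < n < 2 ^ (2 ^ h.+1))%N) ->
  (forall n, n \in s -> 0 <= delta n <= 2^-1) ->
  2 ^+ h <= \sum_(n <- s) delta n * (totient n)%:R ->
  measurable V ->
  (forall n a, n \in s -> (a < n)%N -> coprime a n ->
     window (a%:R / n%:R) (delta n) `&` `[0, 1[%classic `<=` V) ->
  (c0%:E <= lambda V)%E.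
Proof.
have [C C0 hC] := sum_close_pairs R.
(* The 2 bounds the diagonal. [24 = 2 * 2 * 3 * 2] collects the factor in [overlap_bound], the two
   orders of a pair, [h + ln H <= 3 * h], and [min x y * (x + y) <= 2 * x * y]. *)
pose C' := 2 + 24 * C; have C'0 : 0 < C' by rewrite /C'; lra.
exists C'^-1; first by rewrite invr_gt0.
move=> h s delta V h0 us sn dn hS mV sV.
have p2 k : 0 < 2 ^+ k :> R by rewrite exprn_gt0.
have sn0 n : n \in s -> (0 < n)%N by move=> /sn/andP[].
set S := \sum_(n <- s) _ in hS.
have S0 : 0 < S by apply: lt_le_trans hS.
pose H := (2 ^ h.+1)%N.
have H2 : (2 <= H)%N by rewrite /H expnS leq_pmulr// expn_gt0.
have lnH : h%:R + ln H%:R <= 3 * h%:R :> R.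
  have -> : ln H%:R = h.+1%:R * ln 2 :> R by rewrite /H natrX lnXn// mulr_natl.
  have : h.+1%:R * ln 2 <= h.+1%:R * 1 :> R by rewrite ler_wpM2l// ln2_le1.
  have : 1 <= h%:R :> R by rewrite ler1n.
  rewrite -natr1; lra.
have total : \sum_(0 <= k < h) 4 ^+ k * overlap_bound s delta k <= h%:R * (C' * S ^+ 2).
  rewrite (eq_bigr (fun k => 2 * S * 2 ^+ k + \sum_(m <- s) \sum_(n <- s)
      2 * Num.min (delta m) (delta n) *
      (2 ^+ k * (close_pairs m n ((delta m + delta n) / 2 ^+ k))%:R +
       2 ^+ k * (close_pairs n m ((delta m + delta n) / 2 ^+ k))%:R))); last first.
    move=> k _; rewrite /overlap_bound -/S mulrDr.
    have -> : 4 ^+ k = 2 ^+ k * 2 ^+ k :> R by rewrite -exprMn; congr (_ ^+ _); ring.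
    congr (_ + _); first by field; rewrite gt_eqF.
    rewrite mulr_sumr; apply: eq_bigr => m _; rewrite mulr_sumr; apply: eq_bigr => n _.
    by field; rewrite gt_eqF.
  rewrite big_split/= -mulr_sumr.
  have pow_sum : \sum_(0 <= k < h) 2 ^+ k <= S.
    apply: le_trans hS; elim: (h) => [|j IH]; first by rewrite big_geq.
    by rewrite big_nat_recr//= exprS; lra.
  rewrite exchange_big/=.
  have pair_sum : \sum_(m <- s) \sum_(0 <= k < h) \sum_(n <- s)
      2 * Num.min (delta m) (delta n) *
      (2 ^+ k * (close_pairs m n ((delta m + delta n) / 2 ^+ k))%:R +
       2 ^+ k * (close_pairs n m ((delta m + delta n) / 2 ^+ k))%:R) <=
    24 * C * h%:R * S ^+ 2.
    rewrite [leRHS](_ : _ = \sum_(m <- s) \sum_(n <- s)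
       24 * C * h%:R * ((delta m * (totient m)%:R) * (delta n * (totient n)%:R))); last first.
      rewrite expr2 /S mulr_suml mulr_sumr; apply: eq_bigr => m _.
      by rewrite mulr_sumr mulr_sumr; apply: eq_bigr => n _; ring.
    rewrite big_seq [leRHS]big_seq; apply: ler_sum => m ms.
    rewrite exchange_big/= big_seq [leRHS]big_seq; apply: ler_sum => n ns.
    have /andP[m0 mH] := sn m ms; have /andP[n0 nH] := sn n ns.
    have /andP[dm0 _] := dn m ms; have /andP[dn0 _] := dn n ns.
    rewrite -mulr_sumr big_split/=.
    have min0 : 0 <= Num.min (delta m) (delta n) by rewrite le_min dm0.
    have eta0 : 0 <= delta m + delta n by rewrite addr_ge0.
    have h1 := hC H h m n _ H2 m0 n0 mH nH eta0.
    have h2 := hC H h n m _ H2 n0 m0 nH mH eta0.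
    apply: (@le_trans _ _ (2 * Num.min (delta m) (delta n) *
      (2 * (C * (3 * h%:R) * (delta m + delta n) * (totient m)%:R * (totient n)%:R)))).
      rewrite ler_wpM2l ?mulr_ge0// [leRHS]mulrDl mul1r lerD//.
        apply: (le_trans h1); rewrite !ler_wpM2r// ler_wpM2l// ltW//.
      apply: (le_trans h2); rewrite mulrAC !ler_wpM2r// ler_wpM2l// ltW//.
    have minle : Num.min (delta m) (delta n) * (delta m + delta n) <=
        2 * (delta m * delta n).
      have [dmn|dnm] := leP (delta m) (delta n).
        by have := ler_wpM2l dm0 dmn; lra.
      by have := ler_wpM2l dn0 (ltW dnm); lra.
    have cst : 0 <= 12 * C * h%:R * (totient m)%:R * (totient n)%:R.
      by rewrite !mulr_ge0// ltW.
    have := ler_wpM2l cst minle; lra.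
  have : 1 <= h%:R :> R by rewrite ler1n.
  move=> h1; have S2 : 0 <= S ^+ 2 by rewrite exprn_ge0// ltW.
  have := ler_wpM2l (ltW S0) pow_sum; rewrite /C'; nra.
have [k kh hk] := exists_le_mean h0 total.
(* This [t] maximises [2 * t * M1 - t ^ 2 * M2] for [M1 = S / 2 ^ k] and [M2 = C' * M1 ^ 2]; the
   maximum is [1 / C']. *)
pose t := 2 ^+ k / (C' * S).
have t0 : 0 <= t by rewrite divr_ge0 ?mulr_ge0// ltW.
have arcV i : i \in reduced_fractions s -> arc delta k i `<=` V.
  case: i => n a; rewrite reduced_fractionsP => /and3P[ns an can] z [wz Jz].
  apply: (sV n a) => //; split => //; move: wz.
  have /andP[d0 _] := dn n ns.
  have : delta n / 2 ^+ k <= delta n.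
    by rewrite ler_pdivrMr// ler_peMr// exprn_ege1// ler1n.
  rewrite /window/= !in_itv/= => h1 /andP[h2 h3]; apply/andP; split; lra.
have := second_moment lambda t0 mV (measurable_arc delta k) arcV.
move=> sm.
have first : ((S / 2 ^+ k)%:E <= \sum_(i <- reduced_fractions s) lambda (arc delta k i))%E.
  have -> : S / 2 ^+ k = \sum_(i <- reduced_fractions s) delta i.1 / 2 ^+ k.
    rewrite sum_reduced_fractions /S mulr_suml; apply: eq_bigr => n _.
    by rewrite /= sum_coprime_const; ring.
  rewrite -sumEFin big_seq [leRHS]big_seq; apply: lee_sum => -[n a].
  rewrite reduced_fractionsP => /and3P[ns an can].
  have /andP[d0 d1] := dn n ns; apply: half_interval_ge.
    by rewrite divr_ge0//= ltr_pdivrMr ?ltr0n ?sn0// mul1r ltr_nat.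
  apply/andP; split; first by rewrite divr_ge0// ltW.
  apply: le_trans d1; by rewrite ler_pdivrMr// ler_peMr// exprn_ege1// ler1n.
have : ((2 / C')%:E <= lambda V + (C'^-1)%:E)%E.
  apply: (@le_trans _ _ ((2 * t)%:E * \sum_(i <- reduced_fractions s) lambda (arc delta k i))%E).
    rewrite (_ : 2 / C' = 2 * t * (S / 2 ^+ k)); last first.
      by rewrite /t; field; rewrite !gt_eqF.
    by rewrite EFinM; apply: lee_wpmul2l => //; rewrite lee_fin mulr_ge0.
  apply: (le_trans sm); apply: leeD => //.
  apply: (@le_trans _ _ ((t ^+ 2)%:E * (overlap_bound s delta k)%:E)%E).
    by apply: lee_wpmul2l; [rewrite lee_fin exprn_ge0|exact: sum_overlap_le].
  rewrite -EFinM lee_fin.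
  have -> : C'^-1 = (C' * S ^+ 2) / (C' * S) ^+ 2.
    by field; rewrite !gt_eqF.
  rewrite /t expr_div_n mulrAC ler_pM2r ?invr_gt0 ?exprn_gt0 ?mulr_gt0//.
  by rewrite -exprM mulnC exprM (_ : 2 ^+ 2 = 4)//; ring.
rewrite -leeBlDr// -EFinB; apply: le_trans; rewrite lee_fin le_eqVlt.
by apply/orP; left; apply/eqP; field; rewrite gt_eqF.
Qed.

End BlockMeasure.

(** * Divergence of the series *)

Section Divergence.
Variable R : realType.

(** Mertens' bound over all primes up to [n], used for the primes of [n]. The loss of a full [ln n]
    is harmless, since later only the logarithm of this bound matters. *)
Lemma totient_ge : exists2 c : R, 0 < c & forall n : nat, (2 <= n)%N ->
  c * n%:R <= ln n%:R * (totient n)%:R.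
Proof.
have [C hC] := mertens_second R; exists (expR (- (C + 1))); first exact: expR_gt0.
move=> n n2; have n0 : (0 < n)%N by lia.
have ln0 : 0 < ln n%:R :> R by rewrite ln_gt0// ltr1n.
rewrite totient_rho// mulrCA [leLHS]mulrC ler_wpM2l//.
have h : \sum_(p <- primes n) p%:R^-1 <= ln (ln n%:R) + C :> R.
  apply: le_trans (hC n n2); rewrite (big_primes _ _ (ltnSn n)).
  rewrite big_ltn_cond//= mem_primes /= big_mkcond [leRHS]big_mkcond/=.
  apply: ler_sum_nat => p _; rewrite mem_primes.
  by case: (prime p) => //=; case: ifP; rewrite // invr_ge0.
have := expR_inv_primes_le R n.
have : expR (- (ln (ln n%:R) + C)) <= expR (- \sum_(p <- primes n) p%:R^-1) :> R.
  by rewrite ler_expR lerN2.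
move=> h1 h2; have := le_trans h1 h2.
have -> : expR (- (ln (ln n%:R) + C)) = (ln n%:R)^-1 * (expR (- (C + 1)) * expR 1) :> R.
  have eC : expR (- C) = expR (- (C + 1)) * expR 1 :> R by rewrite -expRD; congr expR; ring.
  by rewrite opprD expRD eC [expR (- ln _)]expRN lnK ?posrE.
rewrite [leRHS]mulrC mulrA ler_pM2r ?expR_gt0// ler_pdivrMl//.
Qed.

Lemma sqr_le_pow2 (k : nat) : (4 <= k)%N -> (k * k <= 2 ^ k)%N.
Proof.
elim: k => // k IH; rewrite leq_eqVlt => /predU1P[<-//|k4].
by rewrite expnS; have := IH k4; nia.
Qed.

Lemma ln2_ge : 2^-1 <= ln 2 :> R.
Proof.
have : ln (1 + (2^-1 - 1)) <= 2^-1 - 1 :> R by apply: le_ln1Dx; lra.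
rewrite (_ : 1 + (2^-1 - 1) = 2^-1); last by ring.
by rewrite lnV ?posrE//; lra.
Qed.

(** Put [L = - ln x >= 2 ^ h / 4]. Then [ln L >= (h - 2) / 2 >= h / 4], and for large [h] this makes
    [ln (ln L) >= 16 / c], whatever the size of [c]. The exponent [c * ln L * ln (ln L)] is thus at
    least [4 * h]. *)
Lemma extra_div_fun_small (c : R) : 0 < c -> exists h1 : nat,
  forall (h : nat) (x : R), (h1 <= h)%N -> 0 < x -> 2 ^+ h <= - ln x * 4 ->
    x < 2^-1 /\ extra_div_fun c x <= x / 2 ^+ (4 * h).
Proof.
move=> c0; pose h1 := (Num.truncn (2 * expR (16 / c) + 2)).+1.
exists (maxn 4 h1) => h x; rewrite geq_max => /andP[h4 hh] x0 hx.
have {}hh : 2 * expR (16 / c) + 2 < h%:R.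
  apply: (@lt_le_trans _ _ h1%:R); last by rewrite ler_nat.
  have /truncn_itv/andP[_ //] : 0 <= 2 * expR (16 / c) + 2.
  by rewrite addr_ge0// mulr_ge0// expR_ge0.
pose L := - ln x; rewrite -/L in hx.
have h16 : 16 <= 2 ^+ h :> R.
  by rewrite -(natrX R 2) (ler_nat R 16) (leq_trans _ (leq_pexp2l _ h4)).
have L_ge : 4 <= L by lra.
have ln2 := ln2_ge.
have x_lt : x < 2^-1.
  rewrite -ltr_ln ?posrE ?invr_gt0// lnV ?posrE//.
  by have := ln2_le1 R; rewrite /L in L_ge; lra.
split => //; rewrite /extra_div_fun gt_eqF// ifT; last by lra.
rewrite ler_wpM2l ?(ltW x0)// -/L.
have lnL : (h%:R - 2) / 2 <= ln L.
  have : ln (2 ^+ h / 4) <= ln L.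
    by rewrite ler_ln ?posrE//; lra.
  rewrite ln_div ?posrE ?exprn_gt0// lnXn// (_ : 4 = 2 ^+ 2); last by ring.
  rewrite lnXn// -[ln 2 *+ h]mulr_natl -[ln 2 *+ 2]mulr_natl.
  have : (4 : R) <= h%:R by rewrite (ler_nat R 4).
  nra.
have e0 := expR_gt0 (16 / c).
have lnlnL : 16 / c <= ln (ln L).
  by rewrite -[leLHS]expRK ler_ln ?posrE//; lra.
have e2 : 2 ^- (4 * h) = expR (- ((4 * h)%:R * ln 2)) :> R.
  by rewrite expRN expRM_natl lnK ?posrE.
rewrite e2 ler_expR -mulrA mulNr lerN2.
apply: (@le_trans _ _ (4 * h%:R)).
  by rewrite natrM -[leRHS]mulr1 ler_wpM2l// ln2_le1.
have : h%:R / 4 <= ln L.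
  have : (4 : R) <= h%:R by rewrite (ler_nat R 4).
  lra.
move=> lnL4; have l0 : 0 <= ln L by apply: le_trans lnL4; rewrite divr_ge0.
have : c * (16 / c) <= c * ln (ln L) by rewrite ler_pM2l.
rewrite mulrCA divff ?gt_eqF// mulr1 => h16c.
by rewrite mulrCA; nra.
Qed.

Variables (psi : nat -> R) (c : R).
Hypothesis psi_ge0 : forall n : nat, (0 < n)%N -> 0 <= psi n.
Hypothesis c_gt0 : 0 < c.

Definition div_term (n : nat) : R :=
  extra_div_fun c (psi n / n%:R) * (totient n)%:R.

Lemma extra_div_fun_ge0 (x : R) : 0 <= x -> 0 <= extra_div_fun c x.
Proof.
move=> x0; rewrite /extra_div_fun; case: ifP => // _; case: ifP => // _.
by rewrite mulr_ge0// expR_ge0.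
Qed.

Lemma div_term_ge0 (n : nat) : (0 < n)%N -> 0 <= div_term n.
Proof. by move=> n0; rewrite mulr_ge0// extra_div_fun_ge0// divr_ge0// psi_ge0. Qed.

Definition diverges (Omega : pred nat) : Prop := forall M : R, exists N : nat,
  M < \sum_(1 <= n < N | Omega n) div_term n.

Lemma divergesU (Omega1 Omega2 : pred nat) : diverges (predU Omega1 Omega2) ->
  diverges Omega1 \/ diverges Omega2.
Proof.
move=> D; apply: contrapT => /not_orP[/existsNP[M1 h1] /existsNP[M2 h2]].
have [N] := D (M1 + M2); rewrite ltNge => /negP; apply.
have le1 : \sum_(1 <= n < N | Omega1 n) div_term n <= M1.
  by rewrite leNgt; apply/negP => lt1; apply: h1; exists N.
have le2 : \sum_(1 <= n < N | Omega2 n) div_term n <= M2.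
  by rewrite leNgt; apply/negP => lt1; apply: h2; exists N.
apply: le_trans (lerD le1 le2).
rewrite big_mkcond [X in _ <= X + _]big_mkcond [X in _ <= _ + X]big_mkcond/=.
rewrite -big_split/=; apply: ler_sum_nat => n /andP[n0 _].
have := div_term_ge0 n0.
by case: (Omega1 n); case: (Omega2 n) => //=; lra.
Qed.

Lemma series_diverges :
  (\sum_(1 <= n <oo) (div_term n)%:E = +oo)%E -> diverges predT.
Proof.
move=> D M; apply: contrapT => nD.
have : (\sum_(1 <= n <oo) (div_term n)%:E <= M%:E)%E.
  apply: lime_le.
    by apply: is_cvg_nneseries => n n0 _; rewrite lee_fin div_term_ge0.
  apply: nearW => N; rewrite sumEFin lee_fin leNgt; apply/negP => h.
  by apply: nD; exists N.
by rewrite D.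
Qed.

Definition in_block (h n : nat) : bool := (2 ^ 2 ^ h <= n < 2 ^ 2 ^ h.+1)%N.

(** The cap [1/2] is the bound on the radii assumed in [block_measure]; it only shrinks the arcs. *)
Definition block_sum (Omega : pred nat) (h : nat) : R :=
  \sum_(2 ^ 2 ^ h <= n < 2 ^ 2 ^ h.+1 | Omega n)
    Num.min 2^-1 (psi n / n%:R) * (totient n)%:R.

Definition big_blocks (Omega : pred nat) : Prop := forall h0 : nat,
  exists2 h : nat, (h0 <= h)%N & 2 ^+ (3 * h) <= block_sum Omega h.

(** Suppose all blocks from [h0] on have sum below [2 ^ (3 * h)]. Then so does each single term, and
    [n >= 2 ^ 2 ^ h] with [totient_ge] forces the capped ratio to be so small that
    [extra_div_fun_small] applies. The block contributes at most [2 ^ (- h)] to the series, which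
    therefore stays bounded. *)
Lemma diverges_big_blocks (Omega : pred nat) :
  diverges Omega -> big_blocks Omega.
Proof.
have step_le (A a b d e : R) : a <= A + 2 - 2 * e -> b <= d -> d <= e ->
    a + b <= A + 2 - e by lra.
have last_le (A a e : R) : a <= A + 2 - e -> 0 <= e -> a <= A + 2 by lra.
move=> D h0; apply: contrapT => nB.
have small h : (h0 <= h)%N -> block_sum Omega h < 2 ^+ (3 * h).
  by move=> hh; rewrite ltNge; apply/negP => bh; apply: nB; exists h.
have [c1 c1_gt0 hc1] := totient_ge.
have [h1 hh1] := extra_div_fun_small c_gt0.
pose h2 := maxn (maxn h0 h1) (maxn 10 (Num.truncn (- ln c1)).+3).
have p2 k : 0 < 2 ^+ k :> R by rewrite exprn_gt0.
have term h n : (h2 <= h)%N -> in_block h n -> Omega n ->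
    div_term n <= Num.min 2^-1 (psi n / n%:R) * (totient n)%:R / 2 ^+ (4 * h).
  rewrite !geq_max => /andP[/andP[h0h h1h] /andP[h10 hc]] nh On.
  have /andP[nl nu] := nh.
  have n2 : (2 <= n)%N by rewrite (leq_trans _ nl)// -[leqLHS]expn1 leq_pexp2l// expn_gt0.
  have n0 : (0 < n)%N by lia.
  have x_ge0 : 0 <= psi n / n%:R by rewrite divr_ge0// psi_ge0.
  rewrite /div_term mulrAC ler_wpM2r//.
  move: x_ge0; rewrite le_eqVlt => /predU1P[<-|x_gt0].
    by rewrite /extra_div_fun eqxx divr_ge0 ?(ltW (p2 _))// le_min lexx andbT.
  set x := psi n / n%:R in x_gt0 *; set y := Num.min 2^-1 x.
  have y0 : 0 < y by rewrite lt_min x_gt0 invr_gt0 ltr0n.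
  have yphi : y * (totient n)%:R <= 2 ^+ (3 * h).
    apply: le_trans (ltW (small h h0h)); rewrite /block_sum big_mkcond/=.
    rewrite (bigD1_seq n)/= ?iota_uniq ?mem_index_iota// On lerDl.
    rewrite big_seq_cond; apply: sumr_ge0 => m /andP[]; rewrite mem_index_iota => /andP[ml _] _.
    case: ifP => // _; rewrite mulr_ge0// le_min invr_ge0 ler0n divr_ge0// psi_ge0//.
    by rewrite (leq_trans _ ml)// expn_gt0.
  have ln_le : ln n%:R <= 2 ^+ h.+1 :> R.
    apply: (@le_trans _ _ (ln (2 ^+ (2 ^ h.+1)))).
      by rewrite ler_ln ?posrE ?ltr0n// -natrX ler_nat ltnW.
    rewrite lnXn// -[leLHS]mulr_natl natrX -[leRHS]mulr1 ler_wpM2l ?(ltW (p2 _))//.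
    exact: ln2_le1.
  have ln_ge : 2 ^+ h / 2 <= ln n%:R :> R.
    apply: (@le_trans _ _ (ln (2 ^+ (2 ^ h)))); last first.
      by rewrite ler_ln ?posrE ?ltr0n// -natrX ler_nat.
    rewrite lnXn// -[leRHS]mulr_natl natrX ler_wpM2l ?(ltW (p2 _))//; exact: ln2_ge.
  have prod_le : y * (c1 * n%:R) <= 2 ^+ (4 * h).+1.
    apply: (@le_trans _ _ (2 ^+ h.+1 * 2 ^+ (3 * h))); last first.
      by rewrite -exprD addSn -mulSn.
    apply: (@le_trans _ _ (y * (ln n%:R * (totient n)%:R))).
      by rewrite ler_wpM2l ?hc1// ltW.
    rewrite mulrCA ler_pM// ?mulr_ge0 ?(ltW y0)//.
    by rewrite ln_ge0// ler1n.
  have ln_sum : ln y + ln c1 + ln n%:R <= 4 * h%:R + 1.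
    have : ln (y * (c1 * n%:R)) <= ln (2 ^+ (4 * h).+1).
      by rewrite ler_ln ?posrE ?mulr_gt0// ltr0n.
    rewrite !lnM ?posrE ?mulr_gt0 ?ltr0n// lnXn// -[ln 2 *+ _]mulr_natl.
    have : (4 * h).+1%:R * ln 2 <= (4 * h).+1%:R * 1 :> R by rewrite ler_wpM2l// ln2_le1.
    rewrite -natr1 natrM; lra.
  have c1_ge : - ln c1 < h%:R - 2.
    apply: (@lt_le_trans _ _ (Num.truncn (- ln c1)).+1%:R); first exact: truncnS_gt.
    by rewrite lerBrDr -natrD ler_nat addn2.
  (* With the bound on [- ln c1] and [(h - 2) ^ 2 >= 5 * h - 1] for [h >= 10], half of [2 ^ h / 2]
     absorbs all linear terms in [ln_sum], leaving [- ln y >= 2 ^ h / 4]. *)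
  have pow_ge : (h%:R - 2) * (h%:R - 2) <= 2 ^+ h / 4 :> R.
    have -> : 2 ^+ h / 4 = (2 ^ (h - 2))%N%:R :> R.
      rewrite natrX; have [k ->] : exists k, h = k.+2.
        by exists (h - 2)%N; rewrite -addn2 subnK// (leq_trans _ h10).
      by rewrite !exprS subSS subSS subn0; field.
    rewrite -natrB; last exact: leq_trans h10.
    by rewrite -natrM ler_nat sqr_le_pow2// (leq_trans _ (leq_sub2r 2 h10)).
  have h10R : (10 : R) <= h%:R by rewrite (ler_nat R 10).
  have [|y_lt hy] := hh1 h y h1h y0; first by nra.
  (* As [y < 1/2], the cap is inactive. *)
  have yx : y = x.
    move: y_lt; rewrite /y; have [h2x|//] := leP 2^-1 x.
    by have := lexx (2^-1 : R); lra.
  by rewrite -yx.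
have block h : (h2 <= h)%N ->
    \sum_(2 ^ 2 ^ h <= n < 2 ^ 2 ^ h.+1 | Omega n) div_term n <= (2 ^+ h)^-1.
  move=> hh; have h0h : (h0 <= h)%N by move: hh; rewrite !geq_max => /andP[/andP[]].
  apply: (@le_trans _ _ (block_sum Omega h / 2 ^+ (4 * h))).
    rewrite /block_sum mulr_suml big_mkcond [leRHS]big_mkcond/=.
    by apply: ler_sum_nat => n nh; case: ifP => // On; exact: term.
  rewrite ler_pdivrMr//; apply: le_trans (ltW (small h h0h)) _.
  by rewrite (_ : (4 * h = h + 3 * h)%N) ?exprD ?mulKf ?gt_eqF//; lia.
pose F M := \sum_(1 <= n < M | Omega n) div_term n.
have F_le j : F (2 ^ 2 ^ (h2 + j))%N <= F (2 ^ 2 ^ h2)%N + 2 - 2 / 2 ^+ j.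
  elim: j => [|j IH]; first by rewrite addn0 expr0; lra.
  have -> : F (2 ^ 2 ^ (h2 + j.+1))%N = F (2 ^ 2 ^ (h2 + j))%N +
      \sum_(2 ^ 2 ^ (h2 + j) <= n < 2 ^ 2 ^ (h2 + j).+1 | Omega n) div_term n.
    rewrite /F addnS (@big_cat_nat _ _ _ (2 ^ 2 ^ (h2 + j)))//=.
      by rewrite expn_gt0.
    by rewrite leq_pexp2l// leq_pexp2l.
  have -> : 2 / 2 ^+ j.+1 = (2 ^+ j)^-1 :> R.
    by rewrite exprS invfM mulrA divff ?mul1r.
  apply: step_le IH (block _ (leq_addr _ _)) _.
  by rewrite lef_pV2 ?posrE//; apply: ler_weXn2l; [rewrite ler1n|rewrite leq_addl].
have [N] := D (F (2 ^ 2 ^ h2)%N + 2); rewrite ltNge => /negP; apply.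
apply: (@le_trans _ _ (F (2 ^ 2 ^ (h2 + N))%N)); last first.
  by apply: last_le (F_le N) _; rewrite divr_ge0.
rewrite /F big_mkcond [leRHS]big_mkcond/=.
apply: ler_sum_nat_support => n /andP[n0 nN]; last by case: ifP => // _; exact: div_term_ge0.
right; split => //; apply: (ltn_trans nN); apply: (@leq_trans (2 ^ N)); first exact: ltn_expl.
by rewrite leq_pexp2l// (leq_trans (ltnW (ltn_expl N (ltnSn 1))))// leq_pexp2l// leq_addl.
Qed.

End Divergence.

(** * Lebesgue density and the zero-one law *)

Section Density.
Variable R : realType.
Notation lambda := (@lebesgue_measure R).

Lemma lebesgue_measure_scale_unique (s : R)
    (nu : {measure set (measurableTypeR R) -> \bar R}) : 0 < s ->
  (forall X, ocitv X -> nu X = (s%:E * lambda X)%E) ->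
  forall A, measurable A -> nu A = (s%:E * lambda A)%E.
Proof.
move=> s0 nuE A mA; have s'0 : 0 <= s^-1 by rewrite invr_ge0 ltW.
have nuX X : ocitv X -> lambda X = mscale (NngNum s'0) nu X.
  move=> /nuE; rewrite /= /mscale/= => ->.
  by rewrite muleA -EFinM mulVf ?gt_eqF// mul1e.
rewrite (lebesgue_measure_unique nuX mA)/= /mscale/= muleA -EFinM divff ?gt_eqF//.
by rewrite mul1e.
Qed.

Lemma lebesgue_measure_affine (b s : R) (B : set R) : 0 < s -> measurable B ->
  lambda ((fun y => (y + b) / s) @^-1` B) = (s%:E * lambda B)%E.
Proof.
move=> s0 mB; pose phi (y : measurableTypeR R) : measurableTypeR R := (y + b) / s.
have mphi : measurable_fun [set: measurableTypeR R] phi.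
  by apply: measurable_funM => //; exact: measurable_funD.
rewrite -[LHS]/(pushforward lambda phi B).
apply: lebesgue_measure_scale_unique => // _ [[x y] _ <-].
rewrite /= /pushforward (_ : phi @^-1` _ = `]s * x - b, s * y - b]%classic); last first.
  apply/seteqP; split => z; rewrite /= !in_itv/= /phi ltr_pdivlMr// ler_pdivrMr//.
    by move=> /andP[h1 h2]; apply/andP; split; lra.
  by move=> /andP[h1 h2]; apply/andP; split; lra.
rewrite !lebesgue_measure_itv/= !lte_fin ltrD2r ltr_pM2l//.
by case: ifP => _; rewrite ?mule0// -!EFinD -EFinM; congr (_%:E); ring.
Qed.

Definition cell (a : R) (m : nat) : set R := `[a, a + 2 ^- m[%classic.

(** At almost every point of [V] the complement has density 0. A cell of length [2 ^- m] around [x]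
    lies in the ball of radius [2 * 2 ^- m], which is four times as long; hence density below
    [e / 4] is requested in the ball. *)
Lemma density_point (V : set R) (e : R) : measurable V -> (0 < lambda V)%E -> 0 < e ->
  exists x : R, exists m0 : nat, forall m : nat, (m0 <= m)%N ->
  forall a : R, a <= x < a + 2 ^- m ->
  (lambda (cell a m `&` ~` V) <= (e * 2 ^- m)%:E)%E.
Proof.
move=> mV V0 e0.
have [N [mN N0 hN]] := lebesgue_density (measurableC mV).
have [x [Vx Nx]] : exists x, V x /\ ~ N x.
  apply: contrapT => h; have VN : V `<=` N.
    by move=> x Vx; apply: contrapT => Nx; apply: h; exists x.
  have : (lambda V <= lambda N)%E by apply: le_measure; rewrite ?inE.
  by rewrite N0 leNgt V0.
have : (lambda (~` V `&` ball x r) * (lambda (ball x r))^-1)%E @[r --> 0^'+]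
    --> (\1_(~` V) x : R)%:E.
  by apply: contrapT => h; exact: Nx (hN _ h).
rewrite indicE (_ : (x \in ~` V) = false); last first.
  by apply/negP; rewrite inE.
move=> /fine_cvgP[_ /cvgrPdist_lt /(_ _ (divr_gt0 e0 (ltr0n _ 4)))].
move=> -[d /= d0 hd].
have dinv0 : 0 <= 4 / d by rewrite divr_ge0// ltW.
exists x, (Num.truncn (4 / d)).+1 => m hm a /andP[ax xa].
pose r : R := 2 * 2 ^- m.
have p2 : 0 < 2 ^- m :> R by rewrite invr_gt0 exprn_gt0.
have r0 : 0 < r by rewrite mulr_gt0.
have rd : r < d.
  have : 4 / d < 2 ^+ m.
    apply: (@lt_trans _ _ m%:R); last by rewrite -natrX ltr_nat ltn_expl.
    by apply: lt_le_trans (truncnS_gt _) _; rewrite ler_nat.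
  rewrite ltr_pdivrMr// => h; rewrite /r ltr_pdivrMr ?exprn_gt0//; lra.
have sub_ball : cell a m `<=` ball x r.
  move=> y; rewrite /cell/= in_itv/= => /andP[ay ya].
  rewrite /ball/= ltr_norml /r; apply/andP; split; lra.
have mball : measurable (ball x r) by exact: measurable_ball.
have mVb : measurable (~` V `&` ball x r) by apply: measurableI => //; exact: measurableC.
have fin : (lambda (~` V `&` ball x r) \is a fin_num)%E.
  rewrite ge0_fin_numE//.
  apply: (@le_lt_trans _ _ (lambda (ball x r))); first by apply: le_measure; rewrite ?inE.
  by rewrite lebesgue_measure_ball ?ltry// ltW.
have rball : ball_ [eta Num.Def.normr] 0 d r by rewrite /ball_/= sub0r normrN gtr0_norm.
have := hd r rball r0; rewrite sub0r normrN => /(le_lt_trans (ler_norm _)).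
rewrite lebesgue_measure_ball ?(ltW r0)// -(fineK fin) inver mulrn_eq0/= gt_eqF//.
rewrite -EFinM/= ltr_pdivrMr; last by rewrite mulrn_wgt0.
move=> hf; apply: (@le_trans _ _ (lambda (~` V `&` ball x r))).
  apply: le_measure; rewrite ?inE//.
    by apply: measurableI; [exact: measurable_itv|exact: measurableC].
  by move=> y [cy nVy]; split => //; exact: sub_ball.
rewrite -(fineK fin) lee_fin; apply: le_trans (ltW hf) _.
by rewrite /r -mulr_natr; lra.
Qed.

End Density.

(** * Limsup sets on the real line and a uniform lower bound for their measure *)

Section Limsup.
Variables (R : realType) (psi : nat -> R).
Hypothesis psi_ge0 : forall n : nat, (0 < n)%N -> 0 <= psi n.
Notation lambda := (@lebesgue_measure R).

Definition unit_itv : set R := `[0, 1[%classic.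

Lemma measurable_unit_itv : measurable unit_itv.
Proof. exact: measurable_itv. Qed.

Notation lambda1 := (mrestr lambda measurable_unit_itv).

Lemma lambda1E (X : set R) : lambda1 X = lambda (X `&` unit_itv).
Proof. by []. Qed.

Lemma lambda1_le1 (X : set R) : measurable X -> (lambda1 X <= 1)%E.
Proof.
move=> mX; have <- : lambda unit_itv = 1%E.
  by rewrite lebesgue_measure_itv/= lte_fin ltr01 oppr0 adde0.
apply: le_measure; rewrite ?inE//; [|exact: measurable_unit_itv].
by apply: measurableI => //; exact: measurable_unit_itv.
Qed.

Lemma lambda1_lty (X : set R) : measurable X -> (lambda1 X < +oo)%E.
Proof. by move=> mX; apply: le_lt_trans (lambda1_le1 mX) _; rewrite ltry. Qed.

(* The preimage in [R] of [approx_set psi n], with an arbitrary numerator and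
   radius [r / n]. *)
Definition approx (n : nat) (r : R) : set R :=
  \bigcup_(a in [set a : int | coprimez a n]) window (a%:~R / n%:R) (r / n%:R).

Lemma approxP (n : nat) (r x : R) : approx n r x <->
  exists2 a : int, coprimez a n & `|x - a%:~R / n%:R| < r / n%:R.
Proof.
split=> [[a /= ca]|[a ca xa]].
  rewrite /window/= in_itv/= => /andP[h1 h2]; exists a => //.
  by rewrite ltr_norml; apply/andP; split; lra.
exists a => //; rewrite /window/= in_itv/=.
by move: xa; rewrite ltr_norml => /andP[h1 h2]; apply/andP; split; lra.
Qed.

Lemma measurable_approx (n : nat) (r : R) : measurable (approx n r).
Proof.
apply: open_measurable; apply: bigcup_open => a _; exact: interval_open.
Qed.

Lemma sub_approx (n : nat) (r s : R) : r <= s -> approx n r `<=` approx n s.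
Proof.
move=> rs x /approxP[a ca xa]; apply/approxP; exists a => //.
by apply: (lt_le_trans xa); rewrite ler_wpM2r// invr_ge0.
Qed.

Definition approx_seq (Omega : pred nat) (t n : nat) : set R :=
  if Omega n then approx n (psi n / 2 ^+ t) else set0.

Lemma measurable_approx_seq (Omega : pred nat) (t n : nat) :
  measurable (approx_seq Omega t n).
Proof. by rewrite /approx_seq; case: ifP => // _; exact: measurable_approx. Qed.

Definition approx_limit (Omega : pred nat) (t : nat) : set R :=
  lim_sup_set (approx_seq Omega t).

Lemma measurable_approx_limit (Omega : pred nat) (t : nat) :
  measurable (approx_limit Omega t).
Proof.
apply: bigcap_measurable => // N _; apply: bigcup_measurable => n _.
exact: measurable_approx_seq.
Qed.

Lemma approx_limitP (Omega : pred nat) (t : nat) (x : R) :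
  approx_limit Omega t x <-> forall N : nat, exists n : nat,
    [/\ (N <= n)%N, (0 < n)%N, Omega n & approx n (psi n / 2 ^+ t) x].
Proof.
split=> [Wx N|h N _].
  (* Starting from [N.+1] makes the denominator positive. *)
  have [n /= Nn] := Wx N.+1 I; rewrite /approx_seq; case: ifP => // On ax.
  by exists n; split => //; lia.
have [n [Nn _ On ax]] := h N; exists n => //.
by rewrite /approx_seq On.
Qed.

Lemma lambda1_lim_sup_ge (F : (set R)^nat) (c : R) :
  (forall n, measurable (F n)) ->
  (forall N, (c%:E <= lambda1 (\bigcup_(n >= N) F n))%E) ->
  (c%:E <= lambda1 (lim_sup_set F))%E.
Proof.
move=> mF cF; have mU N : measurable (\bigcup_(n >= N) F n) by exact: bigcup_measurable.
have cv := lim_sup_set_cvg lambda1 F mF (lambda1_lty (mU 0%N)).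
have <- := cvg_lim (@ereal_hausdorff R) cv.
by apply: lime_ge; [apply/cvg_ex; eexists; exact: cv|exact: nearW].
Qed.

(** The same [c0] serves every [t] and [Omega]: a block sum of [2 ^ (3 * h)] stays above [2 ^ h]
    after division by [2 ^ t] once [h >= t]. Continuity from above passes from the tails to the
    limsup. *)
Lemma approx_limit_measure_ge : exists2 c0 : R, 0 < c0 &
  forall (Omega : pred nat) (t : nat), big_blocks psi Omega ->
  (c0%:E <= lambda1 (approx_limit Omega t))%E.
Proof.
have [c0 c0_gt0 hc0] := block_measure R; exists c0 => // Omega t big.
apply: lambda1_lim_sup_ge => [n|N]; first exact: measurable_approx_seq.
(* [h > N] puts all denominators of the block beyond [N], [h >= t] leaves room for the scaling, and
   [h] is positive. *)
have [h hN big_h] := big (N + t).+1.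
pose s := [seq n <- index_iota (2 ^ 2 ^ h) (2 ^ 2 ^ h.+1) | Omega n].
have p2 k : 0 < 2 ^+ k :> R by rewrite exprn_gt0.
pose delta n := Num.min 2^-1 (psi n / n%:R) / 2 ^+ t.
have sP n : n \in s -> [/\ Omega n, (0 < n)%N, (h <= n)%N & (n < 2 ^ 2 ^ h.+1)%N].
  rewrite mem_filter mem_index_iota => /and3P[On nl nu]; split => //.
    by apply: leq_trans nl; rewrite expn_gt0.
  apply: leq_trans nl; apply/ltnW/(ltn_trans (ltn_expl h (ltnSn 1))).
  exact: ltn_expl.
have min0 n : n \in s -> 0 <= Num.min 2^-1 (psi n / n%:R).
  by move=> /sP[_ n0 _ _]; rewrite le_min invr_ge0 ler0n divr_ge0// psi_ge0.
rewrite lambda1E; apply: (hc0 h s delta).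
- by case: (h) hN.
- by rewrite filter_uniq// iota_uniq.
- by move=> n /sP[_ -> _ ->].
- move=> n ns; have h0 := min0 n ns; rewrite /delta divr_ge0 ?(ltW (p2 t))//=.
  rewrite ler_pdivrMr//; have : (1 : R) <= 2 ^+ t by rewrite exprn_ege1// ler1n.
  have : Num.min 2^-1 (psi n / n%:R) <= 2^-1 :> R by rewrite ge_min lexx.
  lra.
- have -> : \sum_(n <- s) delta n * (totient n)%:R = block_sum psi Omega h / 2 ^+ t.
    rewrite /block_sum -[X in _ = X / _]big_filter mulr_suml; apply: eq_bigr => n _.
    by rewrite /delta mulrAC.
  rewrite ler_pdivlMr// (le_trans _ big_h)// -exprD.
  by apply: ler_weXn2l; [rewrite ler1n|lia].
- apply: measurableI; [|exact: measurable_unit_itv].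
  by apply: bigcup_measurable => n _; exact: measurable_approx_seq.
move=> n a ns an can x [wx ux]; split => //.
have [On n0 hn _] := sP n ns.
exists n; first by rewrite /=; lia.
rewrite /approx_seq On; exists (a : int); first by rewrite /= coprimezE.
have : delta n <= psi n / 2 ^+ t / n%:R.
  by rewrite /delta mulrAC ler_wpM2r ?invr_ge0 ?(ltW (p2 t))// ge_min lexx orbT.
move: wx; rewrite /window/= !in_itv/= => /andP[h1 h2] h3.
by apply/andP; split; lra.
Qed.

End Limsup.

(** * Two criteria for full measure *)

Section ZeroOne.
Variable R : realType.
Notation lambda := (@lebesgue_measure R).
Notation lambda1 := (mrestr lambda (@measurable_unit_itv R)).

Lemma lambda1_full (V : set R) : measurable V -> lambda1 (~` V) = 0%E ->
  lambda1 V = 1%E.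
Proof.
move=> mV V0; have : lambda1 (V `|` ~` V) = 1%E.
  rewrite setUv lambda1E setTI /unit_itv lebesgue_measure_itv/= lte_fin ltr01.
  by rewrite oppr0 adde0.
rewrite measureU ?setICr//; last exact: measurableC.
by move=> <-; rewrite [X in (_ + X)%E]V0 adde0.
Qed.

Lemma lambda1_le (V : set R) : measurable V -> (lambda1 V <= lambda V)%E.
Proof.
move=> mV; rewrite lambda1E; apply: le_measure; rewrite ?inE//.
by apply: measurableI => //; exact: measurable_unit_itv.
Qed.

(* Near a density point of [V] an interval of length [2 ^- m] is almost filled by
   [V], and [m] applications of the expanding map spread it over the circle. *)
Lemma expanding_full (V : set R) (tau : R) : measurable V ->
  (forall (x : R) (j : int), V x -> V (x + j%:~R)) ->
  (forall x : R, V x -> V (2 * x + tau)) ->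
  (0 < lambda V)%E -> lambda1 (~` V) = 0%E.
Proof.
move=> mV per expV V0; apply/eqP; rewrite eq_le measure_ge0 andbT.
apply/lee_addgt0Pr => e e0; rewrite add0e.
have [x [m hm]] := density_point mV V0 e0.
(* The [m]-th iterate of [x -> 2 * x + tau] is [y -> 2 ^ m * y + b]. *)
pose b := (2 ^+ m - 1) * tau.
have p2 : 0 < 2 ^+ m :> R by rewrite exprn_gt0.
have iter y : V y -> V (2 ^+ m * y + b).
  rewrite /b; elim: (m) y => [|k IH] y Vy; first by rewrite expr0 mul1r subrr mul0r addr0.
  have := expV _ (IH _ Vy); rewrite exprS; congr (V _); ring.
(* [cell a m] contains the density point and is mapped by this iterate onto [[j, j + 1[]; integer
   periodicity moves the image to [[0, 1[]. *)
pose j := Num.floor (2 ^+ m * x + b); pose a := (j%:~R - b) / 2 ^+ m.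
have /andP[jl ju] : j%:~R <= 2 ^+ m * x + b < j%:~R + 1.
  by have := floor_itv (2 ^+ m * x + b); rewrite intrD.
have ax : a <= x < a + 2 ^- m.
  have -> : a + 2 ^- m = (j%:~R - b + 1) / 2 ^+ m by rewrite [RHS]mulrDl mul1r.
  rewrite /a ler_pdivrMr// ltr_pdivlMr//.
  by apply/andP; split; lra.
have := hm m (leqnn m) a ax => hcell.
have mC : measurable (cell a m `&` ~` V).
  by apply: measurableI; [exact: measurable_itv|exact: measurableC].
apply: (@le_trans _ _ ((2 ^+ m)%:E * lambda (cell a m `&` ~` V))%E); last first.
  apply: (@le_trans _ _ ((2 ^+ m)%:E * (e * 2 ^- m)%:E)%E).
    by apply: lee_wpmul2l => //; rewrite lee_fin ltW.
  by rewrite -EFinM lee_fin mulrCA divff ?mulr1// gt_eqF.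
rewrite -(lebesgue_measure_affine (j%:~R - b) p2 mC) lambda1E.
apply: le_measure; rewrite ?inE.
- by apply: measurableI; [exact: measurableC|exact: measurable_unit_itv].
- rewrite -[X in measurable X]setTI.
  have mphi : measurable_fun [set: measurableTypeR R]
      (fun y : measurableTypeR R => (y + (j%:~R - b)) / 2 ^+ m : measurableTypeR R).
    by apply: measurable_funM => //; exact: measurable_funD.
  exact: mphi.
move=> y [nVy]; rewrite /unit_itv /= in_itv/= => /andP[y0 y1]; split.
  rewrite /cell/= in_itv/=.
  have -> : a + 2 ^- m = (j%:~R - b + 1) / 2 ^+ m by rewrite [RHS]mulrDl mul1r.
  by rewrite /a ler_pM2r ?invr_gt0// ltr_pM2r ?invr_gt0//; apply/andP; split; lra.
move=> /iter Vy; apply: nVy; have := per _ (- j) Vy; congr (V _).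
by rewrite intrN; field; rewrite gt_eqF.
Qed.

(** Otherwise the complement of [W] has a density point, and some cell of length [2 ^- m] meets [W],
    hence [U], in a proportion at most [c / 2]. By periodicity this holds in each of the [2 ^ m]
    cells of [[0, 1[], so [U] has measure at most [c / 2], a contradiction. *)
Lemma periodic_full (W : set R) (c : R) : measurable W -> 0 < c ->
  (forall m : nat, exists U : set R, [/\ measurable U, U `<=` W,
     forall (x : R) (j : int), U x -> U (x + j%:~R * 2 ^- m) &
     (c%:E <= lambda1 U)%E]) ->
  lambda1 (~` W) = 0%E.
Proof.
move=> mW c0 hU; apply/eqP; rewrite eq_le measure_ge0 andbT leNgt; apply/negP => nW.
have mnW : measurable (~` W) by exact: measurableC.
have c2 : 0 < c / 2 by rewrite divr_gt0.
have nW' : (0 < lambda (~` W))%E by apply: lt_le_trans nW (lambda1_le mnW).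
have [x [m hm]] := density_point mnW nW' c2.
have [U [mU UW per cU]] := hU m.
have p2 : 0 < 2 ^+ m :> R by rewrite exprn_gt0.
pose j := Num.floor (2 ^+ m * x); pose a : R := j%:~R * 2 ^- m.
have /andP[jl ju] : j%:~R <= 2 ^+ m * x < j%:~R + 1.
  by have := floor_itv (2 ^+ m * x); rewrite intrD.
have ax : a <= x < a + 2 ^- m.
  have -> : a + 2 ^- m = (j%:~R + 1) / 2 ^+ m by rewrite [RHS]mulrDl mul1r.
  by rewrite /a ler_pdivrMr// ltr_pdivlMr// [x * _]mulrC jl.
have := hm m (leqnn m) a ax; rewrite setCK => hcell.
have mcell (z : R) : measurable (cell z m) by exact: measurable_itv.
have mUc b : measurable (U `&` cell b m) by apply: measurableI.
have mUa := mUc a.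
pose b (i : nat) : R := i%:R * 2 ^- m.
have cellU i : (lambda (U `&` cell (b i) m) <= (c / 2 * 2 ^- m)%:E)%E.
  apply: (@le_trans _ _ (lambda (U `&` cell a m))); last first.
    apply: le_trans hcell; apply: le_measure; rewrite ?inE; [exact: mUa|exact: (measurableI _ _ (mcell a) mW)|].
    by move=> y [Uy cy]; split => //; exact: UW.
  rewrite -[leRHS]mul1e -(lebesgue_measure_affine (a - b i) ltr01 mUa).
  apply: le_measure; rewrite ?inE.
  - exact: mUc.
  - rewrite -[X in measurable X]setTI.
    have mphi : measurable_fun [set: measurableTypeR R]
        (fun y : measurableTypeR R => (y + (a - b i)) / 1 : measurableTypeR R).
      by apply: measurable_funM => //; exact: measurable_funD.
    exact: mphi.
  move=> y [Uy]; rewrite /cell/= !in_itv/= divr1 => /andP[h1 h2]; split.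
    have -> : y + (a - b i) = y + (j - i%:Z)%:~R * 2 ^- m.
      by rewrite /a /b intrB; ring.
    exact: per.
  by apply/andP; split; lra.
have : (lambda1 U <= (c / 2)%:E)%E.
  rewrite lambda1E.
  apply: (@le_trans _ _ (lambda (\big[setU/set0]_(i < (2 ^ m)%N) (U `&` cell (b i) m)))).
    apply: le_measure; rewrite ?inE.
    - by apply: measurableI => //; exact: measurable_unit_itv.
    - by apply: bigsetU_measurable => i _; exact: mUc.
    rewrite -(bigcup_mkord _ (fun i => U `&` cell (b i) m)) => y [Uy].
    rewrite /unit_itv/= in_itv/= => /andP[y0 y1]; exists (Num.truncn (2 ^+ m * y)).
      rewrite /= -(ltr_nat R) natrX.
      have /andP[h _] := truncn_itv (mulr_ge0 (ltW p2) y0).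
      by apply: le_lt_trans h _; rewrite -[ltRHS]mulr1 ltr_pM2l.
    split => //; rewrite /cell/= in_itv/=.
    have -> : b (Num.truncn (2 ^+ m * y)) + 2 ^- m =
        (Num.truncn (2 ^+ m * y)).+1%:R / 2 ^+ m by rewrite -[(Num.truncn _).+1%:R]natr1 [RHS]mulrDl mul1r.
    by rewrite /b ler_pdivrMr// ltr_pdivlMr// [y * _]mulrC truncn_itv// mulr_ge0// ltW.
  apply: le_trans (@Boole_inequality _ _ _ lambda (fun i => U `&` cell (b i) m) _ (fun i _ => mUc (b i))) _.
  apply: (@le_trans _ _ (\sum_(i < (2 ^ m)%N) (c / 2 * 2 ^- m)%:E)%E).
    by apply: lee_sum => i _; exact: cellU.
  rewrite sumEFin lee_fin sumr_const card_ord -[leLHS]mulr_natr natrX.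
  by rewrite divfK// gt_eqF.
move=> /(le_trans cU); rewrite lee_fin; apply/negP; rewrite -ltNge; lra.
Qed.

End ZeroOne.


(** * Translations and doubling of the approximation sets *)

Section Invariance.
Variable R : realType.

Lemma approx_translate (n m : nat) (r x : R) (j : int) :
  (0 < m)%N -> (m %| n)%N -> (0 < n)%N ->
  (forall a b : int, coprimez a n -> coprimez (a + b * (n %/ m)%N) n) ->
  approx n r x -> approx n r (x + j%:~R / m%:R).
Proof.
move=> m0 mn n0 hm /approxP[a ca xa]; apply/approxP.
exists (a + j * (n %/ m)%N); first exact: hm.
have nE : n%:R = (n %/ m)%N%:R * m%:R :> R by rewrite -natrM divnK.
have m0R : m%:R != 0 :> R by rewrite pnatr_eq0 -lt0n.
have q0R : (n %/ m)%N%:R != 0 :> R by rewrite pnatr_eq0 -lt0n divn_gt0// dvdn_leq.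
move: xa; congr (`|_| < _); rewrite intrD intrM nE; field.
by rewrite m0R q0R.
Qed.

Lemma approx_translate_int (n : nat) (r x : R) (j : int) :
  (0 < n)%N -> approx n r x -> approx n r (x + j%:~R).
Proof.
move=> n0 nx; have := @approx_translate n 1 r x j (ltn0Sn _) (dvd1n _) n0 _ nx.
rewrite divr1; apply=> a b; rewrite divn1 /coprimez.
by rewrite ![gcdz _ n]gcdzC addrC gcdzMDl.
Qed.

(** For [n = l * 2 ^ k.+1] the translation adds a multiple of [2 * l] to the numerator, which
    preserves both its coprimality to [l] and its parity. *)
Lemma approx_translate_pow2 (n k : nat) (r x : R) (j : int) :
  (0 < n)%N -> (2 ^ k.+1 %| n)%N -> approx n r x -> approx n r (x + j%:~R * 2 ^- k).
Proof.
move=> n0 /dvdnP[l nE] nx.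
have p2 : (0 < 2 ^ k)%N by rewrite expn_gt0.
rewrite -natrX; apply: approx_translate => // [|a b].
  by rewrite nE expnS mulnA dvdn_mull.
have -> : (n %/ 2 ^ k)%N = (l * 2)%N by rewrite nE expnS mulnA mulnK.
rewrite nE !PoszM !coprimezMr => /andP[al a2].
have a2' : coprimez a 2 by apply: coprimez_dvdr a2; rewrite /= expnS dvdn_mulr.
apply/andP; split.
  by rewrite /coprimez gcdzC [b * _]mulrCA mulrC addrC gcdzMDl gcdzC.
rewrite -[Posz (2 ^ k.+1)]/(2 ^ k.+1)%N%:Z.
have -> : Posz (2 ^ k.+1) = (2 : int) ^+ k.+1 by rewrite -rmorphXn/= natz.
apply: coprimezXr.
by rewrite /coprimez gcdzC mulrA addrC gcdzMDl gcdzC.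
Qed.

(* The translation by [2 ^- k] makes the doubling map preserve reduced fractions
   whose denominator is exactly divisible by [2 ^ k]. *)
Lemma approx_double (n k : nat) (r x : R) :
  (2 ^ k %| n)%N -> ~~ (2 ^ k.+1 %| n)%N ->
  approx n r x -> approx n (2 * r) (2 * x + 2 ^- k).
Proof.
move=> /dvdnP[l nE] nk /approxP[a ca xa]; apply/approxP.
have l_odd : ~~ (2 %| l)%N.
  by apply: contra nk => l2; rewrite nE expnS dvdn_mul.
have n0 : (0 < n)%N.
  by rewrite nE muln_gt0 expn_gt0 andbT; case: (l) l_odd.
(* With [n = l * 2 ^ k] one has [2 * (a / n) + 2 ^- k = (2 * a + l) / n]. As [l] is odd, the new
   numerator is odd, and it is coprime to [l] because [2 * a] is. *)
exists (2 * a + l).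
  move: ca; rewrite nE !PoszM !coprimezMr => /andP[al ak].
  have l2 : coprimez 2 l by rewrite coprimezE /= prime_coprime.
  apply/andP; split.
    rewrite /coprimez gcdzC -[X in _ + X]mul1r addrC gcdzMDl gcdzC.
    by rewrite -/(coprimez _ _) coprimezMl l2 al.
  have -> : Posz (2 ^ k) = (2 : int) ^+ k by rewrite -rmorphXn/= natz.
  apply: coprimezXr; rewrite /coprimez gcdzC [2 * a]mulrC gcdzMDl.
  exact: l2.
have -> : 2 * x + 2 ^- k - (2 * a + l)%:~R / n%:R = 2 * (x - a%:~R / n%:R).
  have lR : l%:R != 0 :> R.
    by rewrite pnatr_eq0; case: (l) l_odd.
  have kR : 2 ^+ k != 0 :> R by rewrite expf_neq0 ?pnatr_eq0.
  rewrite intrD intrM nE natrM natrX; field.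
  by rewrite kR lR.
rewrite normrM ger0_norm// -mulrA ltr_pM2l//.
Qed.

Lemma approx_set_preimage (psi : nat -> R) (n : nat) :
  @circle_proj R @^-1` approx_set psi n = approx n (psi n).
Proof.
apply/seteqP; split => x /=.
  move=> [a [/= /andP[a0 an] ca]] [y].
  rewrite /= in_itv/= => /andP[h1 h2] /esym/circle_proj_eq.
  move=> /intrP[z zE]; have n0 : (0 < n)%N by lia.
  have n0R : (0 : R) < n%:R by rewrite ltr0n.
  have -> : x = y + z%:~R by rewrite -zE; ring.
  apply: approx_translate_int => //; apply/approxP; exists a; first by rewrite coprimezE.
  rewrite mulrBl in h1; rewrite mulrDl in h2.
  by rewrite ltr_norml; apply/andP; split; lra.
move=> /approxP[a ca xa].
(* For [n = 0] the radius is 0, by division by zero, and the set is empty. *)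
have n0 : (0 < n)%N.
  rewrite lt0n; apply/eqP => n0; move: xa; rewrite n0 invr0 !mulr0.
  by rewrite normr_lt0.
have n0R : (0 : R) < n%:R by rewrite ltr0n.
(* Dividing [a - 1] rather than [a] puts the residue [b + 1] in the range from 1 to [n] used by
   [approx_set]. *)
pose q := ((a - 1) %/ n)%Z; pose b := `|((a - 1) %% n)%Z|%N.
have bE : a = q * n + b.+1%:Z.
  have := divz_eq (a - 1) n; rewrite -/q => aE.
  have -> : b.+1%:Z = ((a - 1) %% n)%Z + 1.
    by rewrite -addn1 PoszD /b gez0_abs// modz_ge0//; lia.
  lia.
have bn : (b < n)%N.
  have := ltz_pmod (a - 1) (n0 : (0 < n%:Z)%R).
  by rewrite /b -ltz_nat gez0_abs// modz_ge0//; lia.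
exists b.+1; first split => //=.
  by move: ca; rewrite bE /coprimez gcdzC gcdzMDl gcdzC.
exists (x - q%:~R).
  move: xa; rewrite bE intrD intrM mulrDl.
  rewrite [_ * n%:~R / _]mulrK ?unitfE ?gt_eqF// ltr_norml => /andP[h1 h2].
  by rewrite /= in_itv/= mulrBl mulrDl; apply/andP; split; lra.
apply/circle_proj_eq; rewrite addrAC subrr sub0r rpredN; exact: intr_int.
Qed.

End Invariance.

(** * The dichotomy on powers of 2 and the conclusion *)

Section Main.
Variables (R : realType) (psi : nat -> R) (c : R).
Hypothesis psi_ge0 : forall n : nat, (0 < n)%N -> 0 <= psi n.
Hypothesis c_gt0 : 0 < c.
Notation lambda := (@lebesgue_measure R).
Notation lambda1 := (mrestr lambda (@measurable_unit_itv R)).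

Lemma sub_approx_limit (Omega : pred nat) (s t : nat) : (s <= t)%N ->
  approx_limit psi Omega t `<=` approx_limit psi Omega s.
Proof.
move=> st x /approx_limitP Wx; apply/approx_limitP => N.
have [n [Nn n0 On ax]] := Wx N; exists n; split => //; apply: sub_approx ax.
rewrite ler_wpM2l ?psi_ge0// lef_pV2 ?posrE ?exprn_gt0//.
by apply: ler_weXn2l; rewrite ?ler1n.
Qed.

Lemma approx_limit_subT (Omega : pred nat) (t : nat) :
  approx_limit psi Omega t `<=` approx_limit psi predT 0.
Proof.
move=> x /(sub_approx_limit (leq0n t)) /approx_limitP Wx; apply/approx_limitP => N.
by have [n [Nn n0 _ ax]] := Wx N; exists n.
Qed.

Lemma diverges_eq (Omega1 Omega2 : pred nat) : Omega1 =1 Omega2 ->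
  diverges psi c Omega1 -> diverges psi c Omega2.
Proof.
move=> e D M; have [N] := D M; exists N.
by under eq_bigl do rewrite -e.
Qed.

(** Doubling a point doubles the radius, which costs one unit of [t]; the intersection over all [t]
    absorbs this loss. The intersection is decreasing, so it keeps measure at least [c0], and
    [expanding_full] applies to it. *)
Lemma exact_pow2_full (k : nat) :
  diverges psi c (fun n => (2 ^ k %| n)%N && ~~ (2 ^ k.+1 %| n)%N) ->
  lambda1 (~` approx_limit psi predT 0) = 0%E.
Proof.
set Omega := (X in diverges _ _ X) => D.
have [c0 c0_gt0 hc0] := approx_limit_measure_ge psi_ge0.
have big := diverges_big_blocks psi_ge0 c_gt0 D.
pose V := \bigcap_t approx_limit psi Omega t.
have mW t := measurable_approx_limit psi Omega t.
have mV : measurable V by exact: bigcapT_measurable.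
have cV : (c0%:E <= lambda1 V)%E.
  have cv : lambda1 \o approx_limit psi Omega @ \oo --> lambda1 V.
    apply: nonincreasing_cvg_mu => //; first exact: lambda1_lty.
    by move=> s t st; apply/subsetPset; exact: sub_approx_limit.
  have <- := cvg_lim (@ereal_hausdorff R) cv.
  apply: lime_ge; first by apply/cvg_ex; eexists; exact: cv.
  by apply: nearW => t /=; exact: hc0.
have V0 : lambda1 (~` V) = 0%E.
  apply: (@expanding_full R V (2 ^- k)) => //.
  - move=> x j Vx t _; apply/approx_limitP => N.
    have /approx_limitP/(_ N)[n [Nn n0 On ax]] := Vx t I.
    by exists n; split => //; exact: approx_translate_int.
  - move=> x Vx t _; apply/approx_limitP => N.
    have /approx_limitP/(_ N)[n [Nn n0 On ax]] := Vx t.+1 I.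
    exists n; split => //; have /andP[kn nk] := On.
    have -> : psi n / 2 ^+ t = 2 * (psi n / 2 ^+ t.+1).
      by rewrite exprS invfM [RHS]mulrCA mulVKf// pnatr_eq0.
    exact: approx_double.
  by apply: lt_le_trans (le_trans cV (lambda1_le mV)).
apply/eqP; rewrite eq_le measure_ge0 andbT -V0; apply: le_measure; rewrite ?inE.
- by apply: measurableC; exact: measurable_approx_limit.
- exact: measurableC.
by apply: subsetC => x /(_ 0%N I); exact: approx_limit_subT.
Qed.

Lemma diverges_full : diverges psi c predT ->
  lambda1 (~` approx_limit psi predT 0) = 0%E.
Proof.
move=> D; have [[k Dk]|nA] := pselect (exists k, diverges psi c
    (fun n => (2 ^ k %| n)%N && ~~ (2 ^ k.+1 %| n)%N)).
  exact: exact_pow2_full Dk.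
(* Multiples of [2 ^ k] are those of exact valuation [k], whose sum does not diverge, together with
   the multiples of [2 ^ k.+1], which must therefore diverge. *)
have DB k : diverges psi c (fun n => 2 ^ k %| n)%N.
  elim: k => [|k IH]; first by apply: diverges_eq D => n; rewrite dvd1n.
  pose Omega n := (2 ^ k %| n)%N && ~~ (2 ^ k.+1 %| n)%N.
  have /(divergesU psi_ge0)[Dk|//] : diverges psi c (predU Omega (fun n => 2 ^ k.+1 %| n)%N).
    apply: diverges_eq IH => n; rewrite /Omega /=.
    have [nk|nk] := boolP (2 ^ k.+1 %| n)%N; last by rewrite andbT orbF.
    by rewrite andbF orFb; apply: dvdn_trans nk; rewrite dvdn_exp2l.
  by exfalso; apply: nA; exists k.
have [c0 c0_gt0 hc0] := approx_limit_measure_ge psi_ge0.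
apply: (periodic_full _ c0_gt0); first exact: measurable_approx_limit.
move=> m; exists (approx_limit psi (fun n => 2 ^ m.+1 %| n)%N 0); split.
- exact: measurable_approx_limit.
- exact: approx_limit_subT.
- move=> x j /approx_limitP Wx; apply/approx_limitP => N.
  have [n [Nn n0 On ax]] := Wx N; exists n; split => //.
  exact: approx_translate_pow2.
apply: hc0; exact: diverges_big_blocks (DB m.+1).
Qed.

End Main.

Theorem theorem1 (R : realType) (psi : nat -> R) (c : R)
  (psi_ge0 : forall n : nat, (0 < n)%N -> 0 <= psi n)
  (c_gt0 : 0 < c)
  (div : (\sum_(1 <= n <oo)
            (extra_div_fun c (psi n / n%:R) * (totient n)%:R)%:E = +oo)%E) :
  circle_lebesgue (approx_limsup psi) = 1%E.
Proof.
rewrite /circle_lebesgue /pushforward.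
(* Measure on the circle is that of the preimage cut to [[0, 1[], so the claim moves to the real
   line. *)
have -> : @circle_proj R @^-1` approx_limsup psi = approx_limit psi predT 0.
  rewrite /approx_limsup /approx_limit /lim_sup_set preimage_bigcap.
  apply: eq_bigcapr => N _; rewrite preimage_bigcup; apply: eq_bigcupr => n _.
  by rewrite approx_set_preimage /approx_seq /= expr0 divr1.
apply: lambda1_full; first exact: measurable_approx_limit.
exact: diverges_full psi_ge0 c_gt0 (series_diverges psi_ge0 div).
Qed.
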